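(* Let $G=(V,E)$ be a countably infinite connected graph with finite degrees, with exhaustion $(G_n)_{n\ge1}$, and let $p:\mathcal C_\to(G)\to[0,1]$ be a weight function such that the loop assumption (stated in the context) holds. For a bijection $\phi:\mathbb N\to V$, let $\mu_\phi$ be the measure on cycle-rooted spanning forests of $G$ associated with the algorithm of loop-erased random walks with weights $p(\gamma)$ and ordering $\phi$. Then $\mu_\phi$ does not depend on $\phi$: for any two bijections $\phi,\tau:\mathbb N\to V$, $\mu_\phi=\mu_\tau$.
   Context: **Cycles and forests.** $\mathcal C_\to(G)$ is the set of oriented simple cycles of $G$. A back-and-forth path $(v,u,v)$ along one edge is not a cycle and is by convention given weight $p=0$. A cycle-rooted spanning forest (CRSF) of $G$ is a subgraph containing all vertices, each of whose connected components contains exactly one cycle. **Exhaustion.** $(G_n)_{n\ge1}$ is an increasing sequence of finite connected induced subgraphs of $G$ with union $G$; $V_n$ is the vertex set of $G_n$; $\partial G_n\subset V_n$ is the set of vertices of $G_n$ having a neighbour in $G$ outside $G_n$. $\mathbb P_v$ is the law of the simple random walk $(X_k)_{k\ge0}$ on $G$ with $X_0=v$. **Loop assumption.** There exist $\alpha>0$, $\beta>0$ such that for every $n\ge1$ and every $v\in\partial G_n$ there is an oriented cycle $\gamma_v$ with all its vertices in $V_{n+1}\setminus(V_n\cup\partial G_{n+1})$ such that $p(\gamma_v)\ge\alpha$ and $\mathbb P_v((X_1,\dots,X_{|\gamma_v|})=\gamma_v)>\beta$. Here $\gamma_v$ is written as a closed vertex sequence $(x_1,\dots,x_k)$ with $x_k=x_1$,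 and $|\gamma_v|=k$. **$p$-loop-erased random walk with boundary condition $W\subset V$.** Let $(X_n)_{n\ge0}$ be a simple random walk on $G$ started at $x$ and $(Y_n)$ i.i.d. uniform on $[0,1]$, independent of $(X_n)$. Maintain a current self-avoiding path, initially $(x)$. At time $n+1$, if the current path is $(x_0,\dots,x_l)$ and $X_{n+1}\notin\{x_0,\dots,x_l\}$, append $X_{n+1}$. If $X_{n+1}=x_i$, a loop $\gamma=(x_i,\dots,x_l,x_i)$ is closed at time $n+1$: if $Y_{n+1}\le p(\gamma)$ the loop is kept and the walk stops; otherwise the loop is erased and the path becomes $(x_0,\dots,x_i)$. The rooting time $T_r$ is the first time a loop is kept (when no boundary condition is imposed), $T_W=\min\{k\ge0: X_k\in W\}$, and the ending time is $T_f=\min(T_r,T_W)$. The $p$-loop-erased random walk with boundary condition $W$ is the path at time $T_f$ (together with the kept loop if $T_f=T_r$). **Algorithm and $\mu_\phi$.** Let $(v_i)_{i\ge1}$ be the enumeration of $V$ given by $\phi$. Take independent families $(X^{(x)}_n)_n$, $(Y^{(x)}_n)_n$, $x\in V$, where for each $x\in V$, $(X^{(x)}_n)_n$ is a simple random walk on $G$ started at $x$ and $(Y^{(x)}_n)_n$ is a sequence of i.i.d. random variables uniform on $[0,1]$. Put $\mathsf F_0=\emptyset$ and $\mathsf F_i=\mathsf F_{i-1}\cup L(v_i)$, where $L(v_i)$ is the $p$-loop-erased random walk started at $v_i$ built from $(X^{(v_i)},Y^{(v_i)})$ with boundary condition $V(\mathsf F_{i-1})$ (vertices of $\mathsf F_{i-1}$).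 Then $\mathsf F=\bigcup_i\mathsf F_i$, and $\mu_\phi$ is the law of $\mathsf F$ on $\{0,1\}^E$ with the cylinder $\sigma$-field. *)

(* Defs.v *)
From HB Require Import structures.
From mathcomp Require Import all_boot all_order all_algebra finmap.
From mathcomp Require Import all_classical all_reals all_analysis.

Set Implicit Arguments.
Unset Strict Implicit.
Unset Printing Implicit Defensive.

Import Order.TTheory GRing.Theory Num.Theory.
Local Open Scope classical_set_scope.
Local Open Scope ring_scope.

Section Graph.
Variables (V : countType) (e : rel V).

Definition simple_graph : Prop := symmetric e /\ irreflexive e.

Definition neighbours (v : V) : set V := [set u | e v u].

Definition locally_finite : Prop := forall v, finite_set (neighbours v).

Definition degree (v : V) : nat := #|` fset_set (neighbours v)|%fset.

(* Connectedness of the subgraph induced on A. *)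
Definition connected_on (A : set V) : Prop :=
  A !=set0 /\
  forall u v, A u -> A v ->
    exists s : seq V, [/\ path e u s, last u s = v & forall x, x \in s -> A x].

(* The sequence is indexed from 0: [G n] is the vertex set of the (n+1)-st
   induced subgraph of the exhaustion. *)
Definition exhaustion (G : nat -> {fset V}) : Prop :=
  [/\ forall n, (G n `<=` G n.+1)%fset,
      forall n, connected_on [set` G n] &
      \bigcup_n [set` G n] = [set: V]].

Definition boundary (A : {fset V}) : set V :=
  [set v | v \in A /\ exists2 u, e v u & u \notin A].

(* An oriented simple cycle (x_1, ..., x_m, x_1) is represented by its list of
   distinct vertices [:: x_1; ...; x_m]; two lists represent the same oriented
   cycle iff they are rotations of each other.  The bound on the size excludes
   back-and-forth paths. *)
Definition simple_cycle (c : seq V) : bool :=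
  [&& (2 < size c)%N, uniq c & cycle e c].

Definition closed_seq (c : seq V) : seq V :=
  if c is x :: _ then rcons c x else [::].

Definition edge : Type :=
  {A : {fset V} | `[< exists u v, e u v /\ A = [fset u; v]%fset >]}.

Definition config : Type := edge -> bool.

Definition cylinder_sigma_field : set (set config) :=
  <<s [set A | exists (a : edge) (b : bool), A = [set w | w a = b]] >>.

End Graph.

Section Weights.
Variables (R : realType) (V : countType) (e : rel V).

(* A map from oriented simple cycles to [0, 1]: only the values on lists
   satisfying [simple_cycle] matter, and they depend on the cycle only, not on
   the vertex at which the list starts. *)
Definition weight_function (p : seq V -> R) : Prop :=
  forall c, simple_cycle e c ->
    0 <= p c <= 1 /\ forall k, p (rot k c) = p c.

(* Back-and-forth loops get weight 0. *)
Definition loop_weight (p : seq V -> R) (c : seq V) : R :=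
  if simple_cycle e c then p c else 0.

Definition srw_step (v u : V) : R := if e v u then (degree e v)%:R^-1 else 0.

(* The probability, under the law of the simple random walk with X_0 = v, that
   (X_1, ..., X_k) is the sequence s, where k is the size of s. *)
Fixpoint srw_prob (v : V) (s : seq V) : R :=
  if s is u :: s' then srw_step v u * srw_prob u s' else 1.

Definition loop_assumption (G : nat -> {fset V}) (p : seq V -> R) : Prop :=
  exists alpha beta : R,
    [/\ 0 < alpha, 0 < beta &
      forall n v, boundary e (G n) v ->
        exists c : seq V,
          [/\ simple_cycle e c,
              forall x, x \in c ->
                [/\ x \in G n.+1, x \notin G n & ~ boundary e (G n.+1) x],
              alpha <= p c &
              beta < srw_prob v (closed_seq c)]].

End Weights.

Section Probability.
Variables (R : realType) (d : measure_display) (Omega : measurableType d).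
Variable P : probability Omega R.

Definition mutually_independent (I : choiceType) (F : I -> set (set Omega)) :=
  forall (J : {fset I}) (A : I -> set Omega),
    (forall i, i \in J -> F i (A i)) ->
    P (\bigcap_(i in [set` J]) A i) = (\prod_(i <- J) P (A i))%E.

Definition sigma_of_walk (V : countType) (X : nat -> Omega -> V) :=
  <<s [set A | exists n v, A = X n @^-1` [set v]] >>.

Definition sigma_of_rv (Y : Omega -> R) : set (set Omega) :=
  [set A | exists2 B : set R, measurable B & A = Y @^-1` B].

Definition sigma_of_rvs (Y : nat -> Omega -> R) :=
  <<s [set A | exists n, sigma_of_rv (Y n) A] >>.

Definition simple_random_walk (V : countType) (e : rel V) (x : V)
    (X : nat -> Omega -> V) : Prop :=
  (forall n v, measurable (X n @^-1` [set v])) /\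
  forall s : seq V,
    P [set o | X 0%N o = x /\ [seq X k o | k <- iota 1 (size s)] = s]
    = (srw_prob R e x s)%:E.

Definition iid_uniform (Y : nat -> Omega -> R) : Prop :=
  [/\ forall n, measurable_fun [set: Omega] (Y n),
      forall n (B : set R), measurable B ->
        P (Y n @^-1` B) = uniform_prob (@ltr01 R) B &
      mutually_independent (fun n => sigma_of_rv (Y n))].

Definition driving_families (V : countType) (e : rel V)
    (X : V -> nat -> Omega -> V) (Y : V -> nat -> Omega -> R) : Prop :=
  [/\ forall x, simple_random_walk e x (X x),
      forall x, iid_uniform (Y x) &
      mutually_independent (fun i : V + V =>
        match i with
        | inl x => sigma_of_walk (X x)
        | inr x => sigma_of_rvs (Y x)
        end)].

End Probability.

Section Algorithm.
Variables (R : realType) (V : countType) (e : rel V) (p : seq V -> R).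

(* [Walking s]: the current self-avoiding path is s.
   [Rooted s]: a loop has been kept; s is the path (x_0, ..., x_l) followed by
   the vertex x_i at which the kept loop (x_i, ..., x_l, x_i) closes. *)
Inductive lerw_state := Walking of seq V | Rooted of seq V.

Definition lerw_trace (S : lerw_state) : seq V :=
  match S with Walking s => s | Rooted s => s end.

Definition is_rooted (S : lerw_state) : bool :=
  if S is Rooted _ then true else false.

Definition lerw_step (S : lerw_state) (x : V) (y : R) : lerw_state :=
  match S with
  | Rooted s => Rooted s
  | Walking s =>
      if x \notin s then Walking (rcons s x)
      else if y <= loop_weight e p (drop (index x s) s) then Rooted (rcons s x)
      else Walking (take (index x s).+1 s)
  end.

Fixpoint lerw (X : nat -> V) (Y : nat -> R) (n : nat) : lerw_state :=
  if n is m.+1 then lerw_step (lerw X Y m) (X n) (Y n)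
  else Walking [:: X 0%N].

(* [None] is the value +oo. *)
Definition first_time (Q : nat -> Prop) : option nat :=
  if pselect (exists n, `[< Q n >]) is left h then Some (ex_minn h) else None.

Definition min_time (s t : option nat) : option nat :=
  match s, t with
  | Some m, Some n => Some (minn m n)
  | Some m, None => Some m
  | None, _ => t
  end.

Definition rooting_time (X : nat -> V) (Y : nat -> R) : option nat :=
  first_time (fun n => is_rooted (lerw X Y n)).

Definition hitting_time (W : set V) (X : nat -> V) : option nat :=
  first_time (fun n => W (X n)).

Definition ending_time (W : set V) (X : nat -> V) (Y : nat -> R) :=
  min_time (rooting_time X Y) (hitting_time W X).

(* The p-loop-erased random walk with boundary condition W, as a vertex
   sequence.  It is undefined if the ending time is infinite; the convention
   here is that it is then empty. *)
Definition lerw_final (W : set V) (X : nat -> V) (Y : nat -> R) : seq V :=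
  if ending_time W X Y is Some n then lerw_trace (lerw X Y n) else [::].

Definition trace_edges (s : seq V) : seq {fset V} :=
  [seq [fset q.1; q.2]%fset | q <- zip s (behead s)].

(* The vertex set and the edge set of F_i; [phi i] is v_(i+1). *)
Fixpoint forest_upto (phi : nat -> V) (X : V -> nat -> V) (Y : V -> nat -> R)
    (i : nat) : set V * set {fset V} :=
  if i is j.+1 then
    let F := forest_upto phi X Y j in
    let L := lerw_final F.1 (X (phi j)) (Y (phi j)) in
    (F.1 `|` [set` L], F.2 `|` [set` trace_edges L])
  else (set0, set0).

Definition forest (phi : nat -> V) (X : V -> nat -> V) (Y : V -> nat -> R) :
    config e :=
  fun a => `[< exists i, (forest_upto phi X Y i).2 (val a) >].

End Algorithm.

Arguments forest {R V} e p phi X Y _.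

(* The law of the random subgraph F, to be evaluated on the cylinder
   sigma-field. *)
Definition forest_law (R : realType) (V : countType) (e : rel V)
    (p : seq V -> R) (d : measure_display) (Omega : measurableType d)
    (P : probability Omega R)
    (X : V -> nat -> Omega -> V) (Y : V -> nat -> Omega -> R)
    (phi : nat -> V) : set (config e) -> \bar R :=
  fun A => P [set o | A (forest e p phi (fun x n => X x n o)
                                        (fun x n => Y x n o))].

(* Main.v *)
Require Import Defs.
From mathcomp Require Import all_boot all_order all_algebra finmap.
From mathcomp Require Import all_classical all_reals all_analysis.
From mathcomp Require Import ring lra zify.

Set Implicit Arguments.
Unset Strict Implicit.
Unset Printing Implicit Defensive.

Import Order.TTheory GRing.Theory Num.Theory numFieldNormedType.Exports.
Local Open Scope classical_set_scope.
Local Open Scope ring_scope.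

(** In a finite domain the law of the algorithm has a formula in which no
    ordering appears, and in the infinite graph the law is a limit of laws in
    finite domains.

    Let [U] be finite, and take everything outside [U] as the initial boundary
    condition.  Once all of [U] is covered, the result is a successor map, which
    sends each vertex of [U] to the next one on the path that covered it.  Give a
    successor map [h] the weight [w(h)], the product of the transition
    probabilities of its arcs and of the weights [p c] of its cycles inside [U],
    and let [Z U] be the sum of all weights.  The claim is that the algorithm
    draws [h] with probability [w(h) / Z U].  Two facts give it.
    - Following a successor map from a vertex [x] yields a self-avoiding path [t]
      that leaves [U] or closes a cycle, and the map is arbitrary on the rest of
      [U]; hence [Z U] is the sum over [t] of [w(t) Z (U \ t)]
      ([weighted_sum_saw_sum]).
    - The loop-erased walk from [x] ends with the path [t] with probability
      [w(t) Z (U \ t) / Z U] ([payoff_saw_sum]).  By induction this is known in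
      the domain without [x], which governs the walk between two erasures at [x];
      the number of such erasures is geometric, so the probability in [U] is
      proportional to [w(t) Z (U \ t)].  The walk leaves a finite set almost
      surely ([transient_fset]), so the probabilities add up to one, and the first
      fact identifies the constant.
    The ratios [Z (U \ t) / Z U] telescope along the algorithm, whichever starting
    vertices are used ([payoff_weighted_sum], [pr_wired]).

    The loop assumption makes every walk root almost surely: at each crossing of
    the boundary of a ball of the exhaustion the walk has a chance, bounded below,
    to close a fresh cycle and keep it ([transient_loop_assumption]).  Therefore,
    with probability tending to one as [n] grows, the first [k] walks root without
    leaving [G n], and then they cannot tell the infinite graph from the domain
    [G n].  Later walks stop when they meet covered vertices, so the status of an
    edge is decided as soon as its endpoints are covered ([wired_state_has_edge]).
    The probability of any finite pattern of edges is thus the limit of quantities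
    that depend on the graph, on [p] and on the exhaustion only ([cvg_pattern]),
    and patterns determine the law. *)

(** * Averages over one step, and harmonic functions of the erased path *)

Section Harmonic.
Variables (R : realType) (V : countType) (e : rel V) (p : seq V -> R) (x0 : V).
Hypothesis Hfin : locally_finite e.
Hypothesis Hp : weight_function e p.
Hypothesis Hdeg : forall v, exists u, e v u.

Local Notation q := (srw_step R e).
Local Notation lw := (loop_weight e p).

Definition nbrs (v : V) : seq V := fset_set (neighbours e v).

Lemma mem_nbrs v u : (u \in nbrs v) = e v u.
Proof.
rewrite /nbrs in_fset_set; last exact: Hfin.
by apply/idP/idP; [move/set_mem | move=> h; apply/mem_set].
Qed.

Lemma degree_gt0 v : (0 < degree e v)%N.
Proof.
have [u euv] := Hdeg v; rewrite /degree cardfs_gt0; apply/fset0Pn; exists u.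
by have := mem_nbrs v u; rewrite euv.
Qed.

Lemma srw_step_ge0 v u : 0 <= q v u.
Proof. by rewrite /srw_step; case: ifP => // _; rewrite invr_ge0. Qed.

Lemma srw_step_gt0 v u : e v u -> 0 < q v u.
Proof. by move=> evu; rewrite /srw_step evu invr_gt0 ltr0n degree_gt0. Qed.

Lemma srw_prob_gt0 v s : path e v s -> 0 < srw_prob R e v s.
Proof.
elim: s v => [|u s IHs] v /=; first by rewrite ltr01.
by case/andP=> evu /IHs; apply: mulr_gt0; apply: srw_step_gt0.
Qed.

Lemma srw_prob_cat v s t :
  srw_prob R e v (s ++ t) = srw_prob R e v s * srw_prob R e (last v s) t.
Proof. by elim: s v => [|u s IHs] v /=; rewrite ?mul1r // IHs mulrA. Qed.

Lemma loop_weight01 c : 0 <= lw c <= 1.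
Proof.
rewrite /loop_weight; case: ifP => [/Hp[] //|_].
by rewrite lexx ler01.
Qed.

Lemma loop_weight_ge0 c : 0 <= lw c.
Proof. by case/andP: (loop_weight01 c). Qed.

Lemma onem_loop_weight_ge0 c : 0 <= 1 - lw c.
Proof. by case/andP: (loop_weight01 c) => _; rewrite subr_ge0. Qed.

Definition next_mean (v : V) (F : V -> R) : R := \sum_(u <- nbrs v) q v u * F u.

Lemma next_mean_const v c : next_mean v (fun=> c) = c.
Proof.
rewrite /next_mean -mulr_suml (_ : \sum_(u <- _) _ = 1) ?mul1r //.
transitivity (\sum_(u <- nbrs v) (degree e v)%:R^-1 : R).
  by apply: eq_big_seq => u; rewrite mem_nbrs /srw_step => ->.
rewrite big_const_seq count_predT iter_addr_0 -[X in X = _]mulr_natr mulVf //.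
by rewrite pnatr_eq0 -lt0n degree_gt0.
Qed.

Lemma eq_next_mean v F F' :
  (forall u, e v u -> F u = F' u) -> next_mean v F = next_mean v F'.
Proof.
by move=> FF'; apply: eq_big_seq => u; rewrite mem_nbrs => /FF' ->.
Qed.

Lemma le_next_mean v F F' :
  (forall u, e v u -> F u <= F' u) -> next_mean v F <= next_mean v F'.
Proof.
move=> FF'; rewrite /next_mean big_seq [leRHS]big_seq; apply: ler_sum => u.
rewrite mem_nbrs => evu.
by apply: ler_wpM2l; [exact: srw_step_ge0 | exact: FF'].
Qed.

Lemma next_meanD v F F' :
  next_mean v (fun u => F u + F' u) = next_mean v F + next_mean v F'.
Proof. by rewrite -big_split /=; apply: eq_bigr => u _; rewrite mulrDr. Qed.

Lemma next_meanZ v c F : next_mean v (fun u => c * F u) = c * next_mean v F.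
Proof. by rewrite mulr_sumr; apply: eq_bigr => u _; rewrite mulrCA. Qed.

(** This is how a positive transition probability turns into a strict
    contraction. *)
Lemma next_mean_le_at v u F (a b : R) : e v u ->
    (forall w, e v w -> F w <= a) -> F u <= b ->
  next_mean v F <= a - q v u * (a - b).
Proof.
move=> evu Fa Fb.
have uq : uniq (nbrs v) by exact: fset_uniq.
have uin : u \in nbrs v by rewrite mem_nbrs.
have eqa : \sum_(w <- nbrs v) q v w * a = a by exact: next_mean_const v a.
rewrite -{1}eqa /next_mean (bigD1_seq u) //= [X in _ <= X - _](bigD1_seq u) //=.
have -> (s : R) : q v u * a + s - q v u * (a - b) = q v u * b + s by ring.
apply: lerD; first by apply: ler_wpM2l => //; exact: srw_step_ge0.
rewrite big_seq_cond [leRHS]big_seq_cond; apply: ler_sum => w.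
rewrite mem_nbrs => /andP[evw _].
by apply: ler_wpM2l; [exact: srw_step_ge0 | exact: Fa].
Qed.

Lemma next_mean_ge_at v u F (a : R) : e v u ->
    (forall w, e v w -> 0 <= F w) -> a <= F u ->
  q v u * a <= next_mean v F.
Proof.
move=> evu F0 Fa; rewrite /next_mean (bigD1_seq u) ?mem_nbrs ?fset_uniq //=.
rewrite -[X in X <= _]addr0; apply: lerD.
  by apply: ler_wpM2l => //; exact: srw_step_ge0.
rewrite big_seq_cond; apply: sumr_ge0 => w; rewrite mem_nbrs => /andP[evw _].
by rewrite mulr_ge0 ?srw_step_ge0 ?F0.
Qed.

Lemma cvg_next_mean v (F : nat -> V -> R) (L : V -> R) :
    (forall u, e v u -> F n u @[n --> \oo] --> L u) ->
  next_mean v (F n) @[n --> \oo] --> next_mean v L.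
Proof.
move=> FL; rewrite /next_mean.
have : {subset nbrs v <= nbrs v} by [].
elim: {1 3 4}(nbrs v) => [|u us IHus] sub.
  by under eq_cvg do rewrite big_nil; rewrite big_nil; exact: cvg_cst.
under eq_cvg do rewrite big_cons; rewrite big_cons; apply: cvgD.
  by apply: cvgMr; apply: FL; rewrite -mem_nbrs sub // mem_head.
by apply: IHus => w wus; apply: sub; rewrite inE wus orbT.
Qed.


Definition loop_at (s : seq V) (u : V) : seq V := drop (index u s) s.
Definition erased_at (s : seq V) (u : V) : seq V := take (index u s).+1 s.

Definition path_in (U : {pred V}) (s : seq V) : bool :=
  [&& s != [::], uniq s & all [in U] s].

Lemma path_in1 (U : {pred V}) x : x \in U -> path_in U [:: x].
Proof. by move=> xU; rewrite /path_in /= andbT. Qed.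

Lemma path_in_last (U : {pred V}) s : path_in U s -> last x0 s \in U.
Proof.
case/and3P=> + _ /allP aU; case: s aU => // z s aU _.
by apply: aU; rewrite /= mem_last.
Qed.

Lemma path_in_rcons (U : {pred V}) s u :
  path_in U s -> u \in U -> u \notin s -> path_in U (rcons s u).
Proof.
case/and3P=> _ us aU uU uns; rewrite /path_in rcons_uniq all_rcons uns us.
by rewrite aU andbT /= uU andbT; case: s {us aU uns}.
Qed.

Lemma last_erased_at s u : u \in s -> last x0 (erased_at s u) = u.
Proof.
move=> us; rewrite /erased_at (take_nth x0) ?index_mem // last_rcons.
by rewrite nth_index.
Qed.

Lemma path_in_erased (U : {pred V}) s u :
  path_in U s -> u \in s -> path_in U (erased_at s u).
Proof.
case/and3P=> _ us aU uin; rewrite /path_in /erased_at take_uniq //=.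
apply/andP; split; first by case: s uin {us aU}.
by apply/allP => w /mem_take; apply: (allP aU).
Qed.

(** One step of the loop-erased walk in the domain [U] from the path [s]. The
    payoff [f] is collected at the final path, either when the walk leaves [U]
    or when it keeps a loop; [g] and [h] are the values of the process after a
    step to a fresh vertex and after an erasure.  Keeping [g] and [h] apart
    covers the walk that is killed at erasures ([h] null), which visits each
    self-avoiding path once. *)
Definition lerw_mean (U : {pred V}) (f g h : seq V -> R) (s : seq V) : R :=
  next_mean (last x0 s) (fun u =>
    if u \in U then
      if u \in s then lw (loop_at s u) * f (rcons s u)
                      + (1 - lw (loop_at s u)) * h (erased_at s u)
      else g (rcons s u)
    else f (rcons s u)).

Lemma eq_lerw_mean_at (U : {pred V}) f f' g g' h h' s :
    (forall u, u \notin U \/ u \in s -> f (rcons s u) = f' (rcons s u)) ->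
    (forall u, u \in U -> u \notin s -> g (rcons s u) = g' (rcons s u)) ->
    (forall u, u \in s -> h (erased_at s u) = h' (erased_at s u)) ->
  lerw_mean U f g h s = lerw_mean U f' g' h' s.
Proof.
move=> ff' gg' hh'; apply: eq_next_mean => u _; case: ifPn => uU.
  by case: ifPn => us; [rewrite ff' ?hh' //; right | exact: gg'].
by rewrite ff' //; left.
Qed.

Lemma eq_lerw_mean (U : {pred V}) f f' g g' h h' s : path_in U s ->
    (forall t, f t = f' t) ->
    (forall t, path_in U t -> g t = g' t) ->
    (forall t, path_in U t -> h t = h' t) ->
  lerw_mean U f g h s = lerw_mean U f' g' h' s.
Proof.
move=> sU ff' gg' hh'; apply: eq_lerw_mean_at => [u _|u uU us|u us]; first exact: ff'.
  by apply: gg'; exact: path_in_rcons.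
by apply: hh'; exact: path_in_erased.
Qed.

Lemma le_lerw_mean (U : {pred V}) f f' g g' h h' s : path_in U s ->
    (forall t, f t <= f' t) ->
    (forall t, path_in U t -> g t <= g' t) ->
    (forall t, path_in U t -> h t <= h' t) ->
  lerw_mean U f g h s <= lerw_mean U f' g' h' s.
Proof.
move=> sU ff' gg' hh'; apply: le_next_mean => u _; case: ifPn => // uU.
case: ifPn => us; last by rewrite gg' // path_in_rcons.
apply: lerD; apply: ler_wpM2l => //; first exact: loop_weight_ge0.
  exact: onem_loop_weight_ge0.
by apply: hh'; exact: path_in_erased.
Qed.

Lemma lerw_mean_const U c s :
  lerw_mean U (fun=> c) (fun=> c) (fun=> c) s = c.
Proof.
rewrite -[RHS](next_mean_const (last x0 s)); apply: eq_next_mean => u _.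
by case: ifP => // _; case: ifP => // _; ring.
Qed.

Lemma lerw_mean_lin U (a b : R) f f' g g' h h' s :
  lerw_mean U (fun t => a * f t + b * f' t) (fun t => a * g t + b * g' t)
    (fun t => a * h t + b * h' t) s
  = a * lerw_mean U f g h s + b * lerw_mean U f' g' h' s.
Proof.
rewrite -!next_meanZ -next_meanD; apply: eq_next_mean => u _.
by case: ifP => // _; case: ifP => // _; ring.
Qed.

Lemma cvg_lerw_mean U f (g : nat -> seq V -> R) (l : seq V -> R) s :
    path_in U s ->
    (forall t, path_in U t -> g n t @[n --> \oo] --> l t) ->
  lerw_mean U f (g n) (g n) s @[n --> \oo] --> lerw_mean U f l l s.
Proof.
move=> sU gl; apply: cvg_next_mean => u _.
case: ifPn => uU; last exact: cvg_cst.
case: ifPn => us; last by apply: gl; exact: path_in_rcons.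
apply: cvgD; first exact: cvg_cst.
by apply: cvgMr; apply: gl; exact: path_in_erased.
Qed.

Definition payoff_within (U : {pred V}) (f : seq V -> R) (n : nat) : seq V -> R :=
  iter n (fun g => lerw_mean U f g g) (fun=> 0).

Definition survival (U : {pred V}) (n : nat) : seq V -> R :=
  iter n (fun g => lerw_mean U (fun=> 0) g g) (fun=> 1).

Lemma payoff_within_survival U n s : path_in U s ->
  payoff_within U (fun=> 1) n s = 1 - survival U n s.
Proof.
elim: n s => [|n IHn] s sU /=; first by rewrite subrr.
transitivity (lerw_mean U (fun=> 1 * 1 + (-1) * 0)
   (fun t => 1 * 1 + (-1) * survival U n t)
   (fun t => 1 * 1 + (-1) * survival U n t) s).
  apply: eq_lerw_mean => // [_|t tU|t tU]; first by ring.
    by rewrite mulN1r mulr1; exact: IHn.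
  by rewrite mulN1r mulr1; exact: IHn.
by rewrite lerw_mean_lin lerw_mean_const mul1r mulN1r.
Qed.

Lemma payoff_within_ge0 (U : {pred V}) f n s : path_in U s -> (forall t, 0 <= f t) ->
  0 <= payoff_within U f n s.
Proof.
move=> + f0; elim: n s => [|n IHn] s sU //=.
by rewrite -[leLHS](lerw_mean_const U 0 s); exact: le_lerw_mean.
Qed.

Lemma payoff_within_le (U : {pred V}) f K n s : path_in U s -> 0 <= K ->
  (forall t, f t <= K) -> payoff_within U f n s <= K.
Proof.
move=> + K0 fK; elim: n s => [|n IHn] s sU //=.
by rewrite -[leRHS](lerw_mean_const U K s); exact: le_lerw_mean.
Qed.

Lemma survival_ge0 (U : {pred V}) n s : path_in U s -> 0 <= survival U n s.
Proof.
elim: n s => [|n IHn] s sU //=.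
by rewrite -[leLHS](lerw_mean_const U 0 s); apply: le_lerw_mean.
Qed.

Lemma survival_le1 (U : {pred V}) n s : path_in U s -> survival U n s <= 1.
Proof.
elim: n s => [|n IHn] s sU //=.
by rewrite -[leRHS](lerw_mean_const U 1 s); apply: le_lerw_mean => // t _; exact: ler01.
Qed.

Lemma survivalS_le (U : {pred V}) n s : path_in U s ->
  survival U n.+1 s <= survival U n s.
Proof.
elim: n s => [|n IHn] s sU; first exact: survival_le1.
by rewrite /survival !iterS; apply: le_lerw_mean.
Qed.

Lemma payoff_withinS_ge (U : {pred V}) f n s : path_in U s -> (forall t, 0 <= f t) ->
  payoff_within U f n s <= payoff_within U f n.+1 s.
Proof.
move=> sU f0; elim: n s sU => [|n IHn] s sU; first exact: payoff_within_ge0.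
by rewrite /payoff_within !iterS; apply: le_lerw_mean.
Qed.

Definition transient (U : {pred V}) : Prop :=
  forall s, path_in U s -> survival U n s @[n --> \oo] --> (0 : R).

Definition harmonic (U : {pred V}) (f g : seq V -> R) : Prop :=
  forall s, path_in U s -> g s = lerw_mean U f g g s.

Definition bounded_paths (U : {pred V}) (g : seq V -> R) : Prop :=
  exists M, forall s, path_in U s -> `|g s| <= M.

(** Optional stopping: what a subharmonic function [g] can exceed the collected
    payoff by is what is left on the surviving walks. *)
Lemma subharmonic_le (U : {pred V}) f g M n s : path_in U s ->
    (forall t, path_in U t -> g t <= lerw_mean U f g g t) ->
    (forall t, path_in U t -> g t <= M) ->
  g s <= payoff_within U f n s + M * survival U n s.
Proof.
move=> + subg gM; elim: n s => [|n IHn] s sU.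
  by rewrite /= add0r mulr1 gM.
pose F t := payoff_within U f n t + M * survival U n t.
have -> : payoff_within U f n.+1 s + M * survival U n.+1 s = lerw_mean U f F F s.
  rewrite -[payoff_within _ _ _ _]mul1r -[LHS]lerw_mean_lin.
  apply: eq_lerw_mean => // [t|t _|t _]; first by rewrite mul1r mulr0 addr0.
    by rewrite mul1r.
  by rewrite mul1r.
by apply: (le_trans (subg s sU)); exact: le_lerw_mean.
Qed.

Lemma harmonic_unique (U : {pred V}) f g g' : transient U ->
    harmonic U f g -> harmonic U f g' ->
    bounded_paths U g -> bounded_paths U g' ->
  forall s, path_in U s -> g s = g' s.
Proof.
move=> trU Hg Hg' [M gM] [M' g'M'].
suff key (h h' : seq V -> R) (N N' : R) : harmonic U f h -> harmonic U f h' ->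
    (forall s, path_in U s -> `|h s| <= N) ->
    (forall s, path_in U s -> `|h' s| <= N') ->
    forall s, path_in U s -> h s <= h' s.
  by move=> s sU; apply/eqP; rewrite eq_le (key g g' M M') ?(key g' g M' M).
move=> Hh Hh' hN h'N' s sU; rewrite -subr_le0.
pose d t := h t - h' t.
have dsub t : path_in U t -> d t <= lerw_mean U (fun=> 0) d d t.
  move=> tU; rewrite /d Hh // Hh' //.
  rewrite -[X in X - _]mul1r -mulN1r -lerw_mean_lin.
  by apply: le_lerw_mean => // t'; rewrite mul1r mulN1r ?subrr.
have dN t : path_in U t -> d t <= N + N'.
  move=> tU; apply: le_trans (ler_norm _) _; apply: le_trans (ler_normB _ _) _.
  by apply: lerD; [exact: hN | exact: h'N'].
have d0 n t : payoff_within U (fun=> 0) n t = 0.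
  elim: n t => [|n IHn] t //=.
  rewrite -[RHS](lerw_mean_const U 0 t); congr lerw_mean;
    by apply/funext => t'; exact: IHn.
have lim0 : (N + N') * survival U n s @[n --> \oo] --> (0 : R).
  by rewrite -[X in _ --> X](mulr0 (N + N')); apply: cvgMr; exact: trU.
rewrite -[leRHS](cvg_lim _ lim0) //; apply: limr_ge.
  by apply/cvg_ex; exists 0.
apply: nearW => n; have := subharmonic_le n sU dsub dN.
by rewrite d0 add0r.
Qed.

(** The limit is monotone, hence exists, for payoffs in the unit interval. *)
Definition payoff (U : {pred V}) (f : seq V -> R) (s : seq V) : R :=
  limn (fun n => payoff_within U f n s).

Definition unit_valued (f : seq V -> R) : Prop := forall t, 0 <= f t <= 1.

Lemma cvg_payoff_within (U : {pred V}) f s : unit_valued f -> path_in U s ->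
  payoff_within U f n s @[n --> \oo] --> payoff U f s.
Proof.
move=> f01 sU; apply: nondecreasing_is_cvgn.
  apply/nondecreasing_seqP => n; apply: payoff_withinS_ge => // t.
  by case/andP: (f01 t).
exists 1 => _ [n _ <-]; apply: payoff_within_le => // t.
by case/andP: (f01 t).
Qed.

Lemma payoff_unit (U : {pred V}) f s : unit_valued f -> path_in U s ->
  0 <= payoff U f s <= 1.
Proof.
move=> f01 sU; have cf := cvg_payoff_within f01 sU.
have cvgf := cvgP _ cf; apply/andP; split.
  apply: limr_ge => //; apply: nearW => n; apply: payoff_within_ge0 => // t.
  by case/andP: (f01 t).
apply: limr_le => //; apply: nearW => n; apply: payoff_within_le => // t.
by case/andP: (f01 t).
Qed.

Lemma payoff_bounded (U : {pred V}) f : unit_valued f ->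
  bounded_paths U (payoff U f).
Proof.
move=> f01; exists 1 => s sU; case/andP: (payoff_unit f01 sU) => ? ?.
by rewrite ger0_norm.
Qed.

Lemma payoff_harmonic (U : {pred V}) f : unit_valued f ->
  harmonic U f (payoff U f).
Proof.
move=> f01 s sU.
have step : payoff_within U f n.+1 s @[n --> \oo]
    --> lerw_mean U f (payoff U f) (payoff U f) s.
  by apply: cvg_lerw_mean => // t tU; exact: cvg_payoff_within.
have shift : payoff_within U f n.+1 s @[n --> \oo] --> payoff U f s.
  rewrite (@cvg_shiftS _ (fun n => payoff_within U f n s)).
  exact: cvg_payoff_within.
by rewrite -(cvg_lim _ step) // (cvg_lim _ shift).
Qed.

Lemma payoff1 (U : {pred V}) s : transient U -> path_in U s ->
  payoff U (fun=> 1) s = 1.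
Proof.
move=> trU sU; apply: cvg_lim => //.
under eq_cvg do rewrite payoff_within_survival //.
have : 1 - survival U n s @[n --> \oo] --> (1 - 0 : R).
  by apply: cvgB; [exact: cvg_cst | exact: trU].
by rewrite subr0.
Qed.

Definition never_ends (U : {pred V}) (s : seq V) : R :=
  limn (fun n => survival U n s).

Lemma cvg_survival (U : {pred V}) s : path_in U s ->
  survival U n s @[n --> \oo] --> never_ends U s.
Proof.
move=> sU; apply: nonincreasing_is_cvgn.
  by apply/nonincreasing_seqP => n; exact: survivalS_le.
by exists 0 => _ [n _ <-]; exact: survival_ge0.
Qed.

Lemma never_ends_unit (U : {pred V}) s : path_in U s ->
  0 <= never_ends U s <= 1.
Proof.
move=> sU; have cs := cvgP _ (cvg_survival sU); apply/andP; split.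
  by apply: limr_ge => //; apply: nearW => n; exact: survival_ge0.
by apply: limr_le => //; apply: nearW => n; exact: survival_le1.
Qed.

Lemma never_ends_harmonic (U : {pred V}) :
  harmonic U (fun=> 0) (never_ends U).
Proof.
move=> s sU.
have step : survival U n.+1 s @[n --> \oo]
    --> lerw_mean U (fun=> 0) (never_ends U) (never_ends U) s.
  by apply: cvg_lerw_mean => // t tU; exact: cvg_survival.
have shift : survival U n.+1 s @[n --> \oo] --> never_ends U s.
  rewrite (@cvg_shiftS _ (fun n => survival U n s)).
  exact: cvg_survival.
by rewrite -(cvg_lim _ step) // (cvg_lim _ shift).
Qed.

Lemma transient_never_ends (U : {pred V}) :
  (forall s, path_in U s -> never_ends U s = 0) -> transient U.
Proof. by move=> h0 s sU; rewrite -(h0 s sU); exact: cvg_survival. Qed.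

(** Applied to [H] the supremum of [h]. *)
Lemma contraction_null (U : {pred V}) (h : seq V -> R) eps : 0 < eps ->
    (forall s, path_in U s -> 0 <= h s <= 1) ->
    (forall H, (forall s, path_in U s -> h s <= H) ->
       forall s, path_in U s -> h s <= H - eps * H) ->
  forall s, path_in U s -> h s = 0.
Proof.
move=> eps0 h01 contr s sU.
pose A := [set h t | t in [set t | path_in U t]].
have hA t : path_in U t -> h t <= sup A.
  move=> tU; apply: ub_le_sup; last by exists t.
  by exists 1 => _ [t' /h01/andP[_ ?] <-].
have : sup A <= sup A - eps * sup A.
  apply: ge_sup; first by exists (h s), s.
  by move=> _ [t tU <-]; exact: contr.
rewrite lerBrDr gerDl pmulr_rle0 // => supA0.
apply/eqP; rewrite eq_le (le_trans (hA s sU) supA0).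
by case/andP: (h01 s sU).
Qed.

Lemma null_step_le (U : {pred V}) h H t u :
    (forall t, path_in U t -> 0 <= h t <= H) -> path_in U t ->
  (if u \in U then
     if u \in t then lw (loop_at t u) * 0 + (1 - lw (loop_at t u)) * h (erased_at t u)
     else h (rcons t u) else 0) <= H.
Proof.
move=> h0H tU; case: ifPn => uU; last first.
  by case/andP: (h0H t tU); exact: le_trans.
case: ifPn => ut; last by case/andP: (h0H _ (path_in_rcons tU uU ut)).
case/andP: (h0H _ (path_in_erased tU ut)) => h0; apply: le_trans.
by rewrite mulr0 add0r ler_piMl // gerBl loop_weight_ge0.
Qed.

(** Each step along a prescribed walk is taken with its transition probability,
    and a loop kept on the way only helps the walk to end. *)
Lemma null_harmonic_le (U : {pred V}) h H ys y s : harmonic U (fun=> 0) h ->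
    (forall t, path_in U t -> 0 <= h t <= H) ->
    path_in U s -> path e (last x0 s) (rcons ys y) -> all [in U] ys -> y \notin U ->
  h s <= H - srw_prob R e (last x0 s) (rcons ys y) * H.
Proof.
move=> Hh h0H; elim: ys s => [|z ys IHys] s sU /=; rewrite Hh //.
  rewrite andbT mulr1 => evy _ yU; rewrite -{2}[H]subr0.
  apply: next_mean_le_at evy _ _ => [w _|]; first exact: null_step_le.
  by rewrite (negbTE yU).
case/andP=> evz pys /andP[zU aU] yU.
have E (a q' : R) : a - q' * (a - (a - srw_prob R e z (rcons ys y) * H))
    = a - q' * srw_prob R e z (rcons ys y) * H by ring.
rewrite -E; apply: next_mean_le_at evz _ _ => [w _|]; first exact: null_step_le.
rewrite [z \in U]zU; case: ifPn => zs.
  have eU := path_in_erased sU zs; have /andP[e0 _] := h0H _ eU.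
  rewrite mulr0 add0r; apply: (@le_trans _ _ (h (erased_at s z))).
    by rewrite ler_piMl // gerBl loop_weight_ge0.
  by have := IHys _ eU; rewrite last_erased_at //; exact.
by have := IHys _ (path_in_rcons sU zU zs); rewrite last_rcons; exact.
Qed.

(** This is how connectedness and infiniteness of the graph are used. *)
Hypothesis Hexit : forall (U : {fset V}) x, x \in U ->
  exists ys y, [/\ path e x (rcons ys y), uniq (x :: ys), all [in U] ys & y \notin U].

Lemma uniform_exit (U : {fset V}) : exists2 eps : R, 0 < eps &
  forall x, x \in U -> exists ys y,
    [/\ path e x (rcons ys y), all [in U] ys, y \notin U &
        eps <= srw_prob R e x (rcons ys y)].
Proof.
have : {subset (U : seq V) <= U} by [].
suff: forall l : seq V, {subset l <= U} -> exists2 eps : R, 0 < eps &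
  forall x, x \in l -> exists ys y,
    [/\ path e x (rcons ys y), all [in U] ys, y \notin U &
        eps <= srw_prob R e x (rcons ys y)] by apply.
elim=> [_|x l IHl sub]; first by exists 1.
have [eps eps0 epsP] : exists2 eps : R, 0 < eps &
  forall x, x \in l -> exists ys y,
    [/\ path e x (rcons ys y), all [in U] ys, y \notin U &
        eps <= srw_prob R e x (rcons ys y)].
  by apply: IHl => z zl; apply: sub; rewrite inE zl orbT.
have [ys [y [pys _ aU yU]]] := Hexit (sub x (mem_head _ _)).
have q0 := srw_prob_gt0 pys.
exists (Num.min eps (srw_prob R e x (rcons ys y))).
  by rewrite lt_min eps0.
move=> z; rewrite inE => /orP[/eqP ->|/epsP[zs [w [? ? ? zle]]]].
  by exists ys, y; rewrite ge_min lexx orbT.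
by exists zs, w; split=> //; rewrite ge_min zle.
Qed.

(** From any current path the walk has a chance, bounded below, to leave [U] along
    a fixed exit path from its current position, whatever it erases on the way. *)
Lemma transient_fset (U : {fset V}) : transient [in U].
Proof.
have [eps eps0 epsP] := uniform_exit U.
apply: transient_never_ends; apply: (contraction_null eps0).
  exact: never_ends_unit.
move=> H hH s sU.
have h01 t : path_in [in U] t -> 0 <= never_ends [in U] t <= H.
  by move=> tU; rewrite hH // andbT; case/andP: (never_ends_unit tU).
have [ys [y [pys aU yU epsle]]] := epsP _ (path_in_last sU).
apply: le_trans (null_harmonic_le (@never_ends_harmonic _) h01 sU pys aU yU) _.
rewrite lerB // ler_wpM2r //; case/andP: (h01 s sU); exact: le_trans.
Qed.

(** * The law of the loop-erased path in a finite domain *)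

Hypothesis Hirr : irreflexive e.

(** After a first vertex [x], the walk behaves as in the domain without [x],
    until it steps back to [x] and closes the loop [belast x t]. *)
Lemma lerw_mean_cons (U : {fset V}) f g h x s : path_in [in U] (x :: s) -> s != [::] ->
  lerw_mean [in U] f g h (x :: s)
  = lerw_mean [in (U `\ x)%fset]
      (fun t => if last x0 t == x
                then lw (belast x t) * f (x :: t) + (1 - lw (belast x t)) * h [:: x]
                else f (x :: t))
      (fun t => g (x :: t)) (fun t => h (x :: t)) s.
Proof.
move=> /and3P[_ /= /andP[xs us] /andP[xU aU]] s0; rewrite /lerw_mean.
have -> : last x0 (x :: s) = last x0 s by case: s s0 {xs us aU}.
apply: eq_next_mean => u _; rewrite !inE /=; rewrite !last_rcons.
have [->|ux] /= := eqVneq u x.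
  by rewrite xU belast_rcons /loop_at /erased_at /= eqxx take0.
case: ifP => // uU; case: ifP => // us'.
by rewrite /loop_at /erased_at /= eq_sym (negbTE ux).
Qed.

Fixpoint saw_iter (U : {fset V}) (psi : seq V -> R) (n : nat) : seq V -> R :=
  if n is m.+1 then lerw_mean [in U] psi (saw_iter U psi m) (fun=> 0) else fun=> 0.

(** A self-avoiding path in [U] can be extended fewer times than [U] has vertices,
    so the iteration is stationary by then: it sums [psi] over the extensions of
    [s] up to the first vertex outside [U] or already visited. *)
Definition saw_sum (U : {fset V}) (psi : seq V -> R) : seq V -> R :=
  saw_iter U psi #|` U|.

Lemma saw_iter_stable (U : {fset V}) psi n s : path_in [in U] s ->
    (#|` U| < size s + n)%N ->
  saw_iter U psi n.+1 s = saw_iter U psi n s.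
Proof.
elim: n s => [|n IHn] s sU.
  rewrite addn0 ltnNge; case/and3P: sU => _ us /allP aU.
  by rewrite uniq_leq_size.
move=> lt; apply: eq_lerw_mean_at => // u uU us; apply: IHn.
  exact: path_in_rcons.
by rewrite size_rcons addSnnS.
Qed.

Lemma saw_sumE (U : {fset V}) psi s : path_in [in U] s ->
  saw_sum U psi s = lerw_mean [in U] psi (saw_sum U psi) (fun=> 0) s.
Proof.
move=> sU; rewrite -[RHS]/(saw_iter U psi #|` U|.+1 s) saw_iter_stable //.
by case: s sU => // z s _; rewrite addSnnS leq_addl.
Qed.

Lemma saw_sum_cons (U : {fset V}) psi x s : path_in [in U] (x :: s) -> s != [::] ->
  saw_sum U psi (x :: s)
  = saw_sum (U `\ x)%fset
      (fun t => if last x0 t == x then lw (belast x t) * psi (x :: t)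
                else psi (x :: t)) s.
Proof.
move=> xsU s0; have xU : x \in U by case/and3P: xsU => _ _ /andP[].
have cU : #|` U| = #|` (U `\ x)%fset|.+1 by rewrite (cardfsD1 x) xU.
rewrite /saw_sum cU; set n := #|` (U `\ x)%fset| in cU *.
rewrite saw_iter_stable ?cU //; last first.
  case: s s0 {xsU} => // z s _ /=; lia.
elim: n {cU} s xsU s0 => [|n IHn] s xsU s0 //=.
rewrite lerw_mean_cons //; apply: eq_lerw_mean_at => // [u _|u uU us].
  by rewrite mulr0 addr0.
apply: IHn; last by case: (s).
move: uU; rewrite -rcons_cons !inE => /andP[ux uU].
by apply: path_in_rcons; rewrite // inE negb_or ux us.
Qed.

Lemma path_in_behead (U : {fset V}) x s : path_in [in U] (x :: s) -> s != [::] ->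
  path_in [in (U `\ x)%fset] s.
Proof.
case/and3P=> _ /= /andP[xs us] /andP[xU /allP aU] s0; rewrite /path_in s0 us.
apply/allP => z zs; rewrite !inE /= (aU z zs) andbT.
by apply: contraNneq xs => <-.
Qed.

Lemma path_in_cons (U : {fset V}) x s : x \in U -> path_in [in (U `\ x)%fset] s ->
  path_in [in U] (x :: s).
Proof.
move=> xU /and3P[s0 us /allP aU]; rewrite /path_in /= us xU /= andbT.
apply/andP; split; first by apply/negP => /aU; rewrite !inE eqxx.
by apply/allP => z /aU; rewrite !inE => /andP[].
Qed.

Definition restart_payoff (f : seq V -> R) (x : V) (E : R) (t : seq V) : R :=
  if last x0 t == x then lw (belast x t) * f (x :: t) + (1 - lw (belast x t)) * E
  else f (x :: t).

Lemma restart_payoff_unit f x E : unit_valued f -> 0 <= E <= 1 ->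
  unit_valued (restart_payoff f x E).
Proof.
move=> f01 /andP[E0 E1] t; rewrite /restart_payoff; case: ifP => // _.
have /andP[f0 f1] := f01 (x :: t); have /andP[l0 l1] := loop_weight01 (belast x t).
by apply/andP; split; nra.
Qed.

(** Both sides are bounded harmonic functions of the path after [x] in the domain
    without [x], where coming back to [x] counts as leaving. *)
Lemma payoff_cons (U : {fset V}) f x s : unit_valued f ->
    path_in [in U] (x :: s) -> s != [::] ->
  payoff [in U] f (x :: s)
  = payoff [in (U `\ x)%fset] (restart_payoff f x (payoff [in U] f [:: x])) s.
Proof.
move=> f01 xsU s0.
have xU : x \in U by case/and3P: xsU => _ _ /andP[].
have E01 := payoff_unit f01 (path_in1 xU : path_in [in U] _).
have r01 := restart_payoff_unit x f01 E01.
pose g t := payoff [in U] f (x :: t); rewrite -[LHS]/(g s).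
apply: (harmonic_unique (@transient_fset (U `\ x)%fset) _ (payoff_harmonic r01)).
- move=> t tU; rewrite /g payoff_harmonic //; last exact: path_in_cons.
  by rewrite lerw_mean_cons //; [exact: path_in_cons | case/and3P: tU].
- exists 1 => t tU; have := payoff_unit f01 (path_in_cons xU tU).
  by case/andP=> ? ?; rewrite ger0_norm.
- exact: payoff_bounded.
- exact: path_in_behead.
Qed.

Lemma saw_sum_lin (U : {fset V}) (a b : R) f f' s :
  saw_sum U (fun t => a * f t + b * f' t) s = a * saw_sum U f s + b * saw_sum U f' s.
Proof.
rewrite /saw_sum; elim: #|` U| s => [|n IHn] s /=; first by rewrite !mulr0 addr0.
rewrite -lerw_mean_lin; apply: eq_lerw_mean_at => // u _.
by rewrite !mulr0 addr0.
Qed.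

Lemma eq_saw_sum (U : {fset V}) f f' s : (forall t, f t = f' t) ->
  saw_sum U f s = saw_sum U f' s.
Proof. by move=> ff'; congr (saw_sum U _ s); apply/funext. Qed.

Definition fset_minus (U : {fset V}) (t : seq V) : {fset V} :=
  [fset z in U | z \notin t]%fset.

Lemma in_fset_minus U t z : (z \in fset_minus U t) = (z \in U) && (z \notin t).
Proof. by rewrite !inE. Qed.

Lemma fset_minus_cons U x t : fset_minus U (x :: t) = fset_minus (U `\ x)%fset t.
Proof.
apply/fsetP => z; rewrite !in_fset_minus !inE negb_or.
by case: (z \in U); case: (z != x); case: (z \in t).
Qed.

Lemma fset_minus_out (U : {fset V}) x u : u \notin U ->
  fset_minus U [:: x; u] = (U `\ x)%fset.
Proof.
move=> uU; apply/fsetP => z; rewrite in_fset_minus !inE negb_or.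
case: (eqVneq z u) => [->|_]; first by rewrite (negbTE uU) andbF.
by rewrite andbT andbC.
Qed.

(** A function [Z] that satisfies [saw_sum]'s recursion from every vertex of
    every domain is a partition function for the walk: the ratio of [Z] after
    and before a final path accounts for all the loops erased on the way to it.
    The argument is a renewal equation at the starting point [x], whose solution
    is pinned down by the total mass being one. *)
Lemma payoff_saw_sum (Z : {fset V} -> R) :
    (forall (U : {fset V}) x, x \in U ->
       Z U = saw_sum U (fun t => Z (fset_minus U t)) [:: x]) ->
  forall (U : {fset V}) x f, x \in U -> unit_valued f ->
  payoff [in U] f [:: x] * Z U = saw_sum U (fun t => Z (fset_minus U t) * f t) [:: x].
Proof.
move=> HZ U; have [n] := ubnP #|` U|; elim: n U => // n IHn U ltUn x f xU f01.
have xU1 : path_in [in U] [:: x] by exact: path_in1.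
have path2 u : e x u -> u \in U -> path_in [in U] [:: x; u].
  move=> exu uU; rewrite -[[:: x; u]]/(rcons [:: x] u); apply: path_in_rcons => //.
  by rewrite inE; apply: contraTneq exu => ->; rewrite Hirr.
(* The total weight of the loops erased at [x], up to the factor [Z]. *)
pose rho := next_mean x (fun u => if u \in U then
   saw_sum (U `\ x)%fset (fun t => if last x0 t == x
     then (1 - lw (belast x t)) * Z (fset_minus (U `\ x)%fset t) else 0) [:: u] else 0).
have renewal f' : unit_valued f' ->
    payoff [in U] f' [:: x] * Z (U `\ x)%fset
    = saw_sum U (fun t => Z (fset_minus U t) * f' t) [:: x]
      + payoff [in U] f' [:: x] * rho.
  move=> f'01; have E01 := payoff_unit f'01 xU1.
  rewrite {1}payoff_harmonic // saw_sumE // /lerw_mean /=.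
  rewrite -next_meanZ mulrC -next_meanZ -next_meanD; apply: eq_next_mean => u exu.
  have ux : u != x by apply: contraTneq exu => ->; rewrite Hirr.
  rewrite -[u \in [in U]]/(u \in U) !mem_seq1 (negbTE ux); case: ifPn => uU; last first.
    by rewrite mulr0 addr0 fset_minus_out.
  have ltU' : (#|` (U `\ x)%fset| < n)%N.
    by rewrite -ltnS (leq_trans _ ltUn) // (cardfsD1 x U) xU.
  have uU' : u \in (U `\ x)%fset by rewrite !inE ux.
  have r01 := restart_payoff_unit x f'01 E01.
  rewrite payoff_cons ?path2 // mulrC IHn //.
  rewrite saw_sum_cons ?path2 // -[X in X + _]mul1r -saw_sum_lin.
  apply: eq_saw_sum => t; rewrite /restart_payoff fset_minus_cons.
  by case: ifP => _; ring.
have one01 : unit_valued (fun=> 1) by move=> t; rewrite ler01 lexx.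
have ZU : Z (U `\ x)%fset = Z U + rho.
  have := renewal _ one01; rewrite payoff1 //; last exact: transient_fset.
  rewrite !mul1r => ->; congr (_ + _); rewrite [RHS](HZ U x) //.
  by apply: eq_saw_sum => t; rewrite mulr1.
by have := renewal f f01; rewrite ZU mulrDr => /addIr.
Qed.

Lemma saw_sum_gt0 (U : {fset V}) psi s ys y : path_in [in U] s ->
    (forall t, 0 <= psi t) ->
    path e (last x0 s) (rcons ys y) -> uniq (s ++ ys) -> all [in U] ys -> y \notin U ->
    0 < psi (s ++ rcons ys y) ->
  0 < saw_sum U psi s.
Proof.
move=> + psi0; have saw0 n t : path_in [in U] t ->
    0 <= saw_iter U psi n t.
  elim: n t => //= n IHn t tU; rewrite -[leLHS](lerw_mean_const [in U] 0 t).
  exact: le_lerw_mean.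
have step0 t u : path_in [in U] t -> 0 <= (if u \in U then
      if u \in t then lw (loop_at t u) * psi (rcons t u)
                      + (1 - lw (loop_at t u)) * 0
      else saw_sum U psi (rcons t u)
    else psi (rcons t u)).
  move=> tU; case: ifPn => // uU; case: ifPn => ut.
    by rewrite mulr0 addr0 mulr_ge0 // loop_weight_ge0.
  by apply: saw0; exact: path_in_rcons.
elim: ys s => [|z ys IHys] s sU /=.
  rewrite andbT cats0 => esy us _ yU psi_gt0; rewrite saw_sumE //.
  apply: (lt_le_trans (mulr_gt0 (srw_step_gt0 esy) psi_gt0)).
  apply: next_mean_ge_at => // [w _|]; first exact: step0.
  by rewrite [y \in _](negbTE yU) cats1.
case/andP=> esz pys us /andP[zU aU] yU psi_gt0; rewrite saw_sumE //.
have zs : z \notin s.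
  by apply: contraTN us => zs; rewrite cat_uniq /= zs andbF.
have szU := path_in_rcons sU zU zs.
have := IHys (rcons s z) szU; rewrite last_rcons !cat_rcons => /(_ pys us aU yU psi_gt0).
move=> gt0; apply: (lt_le_trans (mulr_gt0 (srw_step_gt0 esz) gt0)).
apply: next_mean_ge_at => // [w _|]; first exact: step0.
by rewrite [z \in _]zU (negbTE zs).
Qed.

(** * The partition function of successor maps *)

Definition upd (g : V -> V) (z y : V) : V -> V := fun w => if w == z then y else g w.

Lemma upd_comm g z z' y y' : z != z' ->
  upd (upd g z y) z' y' = upd (upd g z' y') z y.
Proof.
move=> zz'; apply/funext => w; rewrite /upd.
by case: (eqVneq w z) => // ->; rewrite (negbTE zz').
Qed.

Fixpoint map_sum (zs : seq V) (F : (V -> V) -> R) (g : V -> V) : R :=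
  if zs is z :: zs' then next_mean z (fun y => map_sum zs' F (upd g z y)) else F g.

Lemma next_mean_exchange z z' (H : V -> V -> R) :
  next_mean z (fun y => next_mean z' (H y))
  = next_mean z' (fun y' => next_mean z (H ^~ y')).
Proof.
rewrite /next_mean; under eq_bigr do rewrite mulr_sumr.
rewrite exchange_big /=; apply: eq_bigr => y' _; rewrite mulr_sumr.
by apply: eq_bigr => y _; rewrite mulrCA.
Qed.

Lemma map_sum_extract zs x F g : uniq zs -> x \in zs ->
  map_sum zs F g = next_mean x (fun y => map_sum (rem x zs) F (upd g x y)).
Proof.
elim: zs g => //= z zs IHzs g /andP[zzs uzs]; rewrite inE.
have [->//|xz /= xzs] := eqVneq x z.
under eq_next_mean => y _ do rewrite IHzs //.
rewrite next_mean_exchange; apply: eq_next_mean => y _.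
by apply: eq_next_mean => y' _; rewrite upd_comm // eq_sym.
Qed.

Lemma map_sum_perm zs zs' F g : uniq zs -> perm_eq zs zs' ->
  map_sum zs F g = map_sum zs' F g.
Proof.
elim: zs' zs g => [|x zs' IH] zs g uzs; first by move/perm_nilP ->.
move=> pzs; have xzs : x \in zs by rewrite (perm_mem pzs) mem_head.
rewrite (map_sum_extract _ _ uzs xzs) /=; apply: eq_next_mean => y _.
apply: IH; first exact: rem_uniq.
by rewrite -(perm_cons x) -(permPl (perm_to_rem xzs)).
Qed.

Lemma eq_map_sum zs F F' g :
    (forall h, (forall w, w \notin zs -> h w = g w) -> F h = F' h) ->
  map_sum zs F g = map_sum zs F' g.
Proof.
elim: zs g => [|z zs IHzs] g FF' /=; first exact: FF'.
apply: eq_next_mean => y _; apply: IHzs => h hg; apply: FF' => w.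
by rewrite inE negb_or => /andP[wz wzs]; rewrite hg // /upd (negbTE wz).
Qed.

Lemma map_sum_base zs F g g' :
    (forall h h', (forall w, w \in zs \/ g w = g' w -> h w = h' w) -> F h = F h') ->
  map_sum zs F g = map_sum zs F g'.
Proof.
elim: zs g g' => [|z zs IHzs] g g' FF /=; first by apply: FF => w [].
apply: eq_next_mean => y _; apply: IHzs => h h' hh'; apply: FF => w.
rewrite inE => hw; apply: hh'; rewrite /upd; case: (eqVneq w z) hw => [_ _|_ /= ?] //.
by right.
Qed.

Lemma map_sumZ zs c F g : map_sum zs (fun h => c * F h) g = c * map_sum zs F g.
Proof.
elim: zs g => //= z zs IHzs g; rewrite -next_meanZ.
by apply: eq_next_mean => y _; exact: IHzs.
Qed.

Lemma le_map_sum zs F F' g : (forall h, F h <= F' h) ->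
  map_sum zs F g <= map_sum zs F' g.
Proof.
move=> FF'; elim: zs g => //= z zs IHzs g.
by apply: le_next_mean => y _; exact: IHzs.
Qed.

Lemma map_sum_ge0 zs F g : (forall h, 0 <= F h) -> 0 <= map_sum zs F g.
Proof.
move=> F0; elim: zs g => //= z zs IHzs g.
by rewrite -[leLHS](next_mean_const z 0); apply: le_next_mean => y _; exact: IHzs.
Qed.

(** ** Cycles of a successor map *)

Definition cycle_through (U : {fset V}) (h : V -> V) (z : V) (c : seq V) : bool :=
  [&& fcycle h c, uniq c, z \in c & all [in U] c].

(** The weight of a cycle is shared equally by its vertices, so that the product
    over a set of vertices counts each cycle of the set once. *)
Definition cycle_share (U : {fset V}) (h : V -> V) (z : V) : R :=
  if pselect (exists c, cycle_through U h z c) is left ex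
  then lw (xchoose ex) `^ (size (xchoose ex))%:R^-1 else 1.

Definition map_weight (U : {fset V}) (h : V -> V) : R :=
  \prod_(z <- U) cycle_share U h z.

Lemma loop_weight_rot k c : lw (rot k c) = lw c.
Proof.
rewrite /loop_weight.
have -> : simple_cycle e (rot k c) = simple_cycle e c.
  by rewrite /simple_cycle size_rot rot_uniq rot_cycle.
by case: ifP => // /Hp[_ ->].
Qed.

Lemma fcycle_traject (h : V -> V) z c : fcycle h (z :: c) ->
  forall i, (i < size c)%N -> nth x0 c i = iter i.+1 h z.
Proof.
move=> /= /fpathE; rewrite size_rcons => tc i ic.
have -> : nth x0 c i = nth x0 (rcons c z) i by rewrite nth_rcons ic.
have ic' : (i < (size c).+1)%N by exact: ltnW.
by rewrite tc (set_nth_default (h z)) ?size_traject // nth_traject // -iterSr iterS.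
Qed.

Lemma fcycle_period (h : V -> V) z c : fcycle h (z :: c) ->
  iter (size c).+1 h z = z.
Proof.
move=> /= /fpathE; rewrite size_rcons => tc.
have {2}-> : z = nth x0 (rcons c z) (size c) by rewrite nth_rcons ltnn eqxx.
by rewrite tc (set_nth_default (h z)) ?size_traject // nth_traject // -iterSr iterS.
Qed.

Lemma fcycle_unique (h : V -> V) z c c' : fcycle h c -> uniq c -> z \in c ->
  fcycle h c' -> uniq c' -> z \in c' -> exists i j, rot i c = rot j c'.
Proof.
have size_le a b : fcycle h (z :: a) -> fcycle h (z :: b) -> z \notin b ->
    (size b <= size a)%N.
  move=> ha hb zb; rewrite leqNgt; apply: contra zb => lt.
  by rewrite -(fcycle_period ha) -(fcycle_traject hb lt) mem_nth.
move=> hc uc zc hc' uc' zc'.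
have [i a ra] := rot_to zc; have [j b rb] := rot_to zc'.
have ha : fcycle h (z :: a) by rewrite -ra rot_cycle.
have hb : fcycle h (z :: b) by rewrite -rb rot_cycle.
have za : z \notin a by move: uc; rewrite -(rot_uniq i) ra => /andP[].
have zb : z \notin b by move: uc'; rewrite -(rot_uniq j) rb => /andP[].
exists i, j; rewrite ra rb; congr cons.
apply: (@eq_from_nth _ x0); first by apply/eqP; rewrite eqn_leq !size_le.
move=> k ka; have kb : (k < size b)%N by apply: leq_trans ka (size_le _ _ hb ha za).
by rewrite (fcycle_traject ha) // (fcycle_traject hb).
Qed.

Lemma cycle_shareE (U : {fset V}) h z c : cycle_through U h z c ->
  cycle_share U h z = lw c `^ (size c)%:R^-1.
Proof.
move=> zc; rewrite /cycle_share; case: pselect => [ex|[]]; last by exists c.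
have /and4P[hc uc cz _] := zc; have /and4P[hc' uc' cz' _] := xchooseP ex.
have [i [j r]] := fcycle_unique hc uc cz hc' uc' cz'.
by rewrite -(loop_weight_rot j) -r loop_weight_rot -(size_rot j) -r size_rot.
Qed.

Lemma cycle_share1 (U : {fset V}) h z : (forall c, ~~ cycle_through U h z c) ->
  cycle_share U h z = 1.
Proof.
by move=> no; rewrite /cycle_share; case: pselect => // -[c cz]; move: (no c); rewrite cz.
Qed.

Lemma eq_cycle_share (U U' : {fset V}) h h' z :
  cycle_through U h z =1 cycle_through U' h' z -> cycle_share U h z = cycle_share U' h' z.
Proof. by move=> /funext eqc; rewrite /cycle_share eqc. Qed.

Lemma map_weight_ge0 (U : {fset V}) h : 0 <= map_weight U h.
Proof.
apply: prodr_ge0 => z _; rewrite /cycle_share.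
by case: pselect => // ex; exact: powR_ge0.
Qed.

Lemma eq_map_weight (U : {fset V}) h h' : {in U, h =1 h'} ->
  map_weight U h = map_weight U h'.
Proof.
move=> hh'; apply: eq_bigr => z _; apply: eq_cycle_share => c.
rewrite /cycle_through; case aU: (all [in U] c); rewrite ?andbF //; congr andb.
apply: (@eq_in_cycle _ [in U]) => // w w' wU _ /=.
by rewrite hh'.
Qed.

Lemma fpath_closed (h : V -> V) (K : {pred V}) a s : fpath h a s -> a \in K ->
    (forall w, w \in a :: s -> w \in K -> h w \in K) -> {subset s <= K}.
Proof.
elim: s a => //= b s IHs a /andP[/eqP hab pbs] aK clK w.
have bK : b \in K by rewrite -hab; apply: clK; rewrite ?mem_head.
rewrite inE => /orP[/eqP-> //|]; apply: IHs pbs bK _ w => w' w's.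
by apply: clK; rewrite inE w's orbT.
Qed.

Lemma fcycle_closed (h : V -> V) (K : {pred V}) a c : fcycle h c -> a \in c ->
    a \in K -> (forall w, w \in c -> w \in K -> h w \in K) -> {subset c <= K}.
Proof.
move=> hc ac aK clK; have [i b rb] := rot_to ac.
have : fcycle h (a :: b) by rewrite -rb rot_cycle.
move=> /= hab w; rewrite -(mem_rot i) rb => wab.
apply: (fpath_closed hab aK) => [w'|]; last by rewrite mem_rcons.
rewrite inE mem_rcons => w'ab; apply: clK.
by rewrite -(mem_rot i) rb; case/orP: w'ab => [/eqP->|//]; rewrite mem_head.
Qed.

Lemma fcycle_step (h : V -> V) c w : fcycle h c -> w \in c -> h w \in c.
Proof.
move=> hc wc; have [i b rb] := rot_to wc.
have : fcycle h (w :: b) by rewrite -rb rot_cycle.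
rewrite -(mem_rot i) rb; case: b {rb} => [|b' b] /=.
  by rewrite andbT => /eqP ->; rewrite mem_head.
by case/andP=> /eqP -> _; rewrite !inE eqxx orbT.
Qed.

(** The orbits of [h] that enter [s] stay in it until they leave [U], so a cycle of
    [h] inside [U] lies in [s] or avoids it. *)
Lemma map_weight_split (U : {fset V}) h s : uniq s -> {subset s <= U} ->
    (forall w, w \in s -> h w \in U -> h w \in s) ->
  map_weight U h = (\prod_(z <- s) cycle_share U h z) * map_weight (fset_minus U s) h.
Proof.
move=> us sU cls; rewrite /map_weight.
have pU : perm_eq U (s ++ fset_minus U s).
  apply: uniq_perm; first exact: fset_uniq.
    rewrite cat_uniq us fset_uniq andbT /=; apply/hasPn => z.
    by rewrite in_fset_minus => /andP[].
  move=> z; rewrite mem_cat in_fset_minus.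
  by case zs: (z \in s) => /=; rewrite ?andbT // (sU _ zs).
rewrite (perm_big _ pU) big_cat /=; congr (_ * _).
apply: eq_big_seq => z; rewrite in_fset_minus => /andP[zU zs].
apply: eq_cycle_share => c; apply/idP/idP => /and4P[hc uc zc /allP aU]; apply/and4P; split=> //.
  apply/allP => w wc; rewrite /= in_fset_minus; apply/andP; split; first exact: aU.
  apply: contra zs => ws; apply: (fcycle_closed hc wc ws) zc => w' w'c w's.
  by apply: cls => //; apply: aU; exact: fcycle_step.
by apply/allP => w /aU; rewrite /= in_fset_minus => /andP[].
Qed.

Lemma fpath_next (h : V -> V) s y w : sorted (frel h) (rcons s y) -> w \in s ->
  h w \in rcons s y.
Proof.
move=> + /splitPr E; case: E => s1 s2; rewrite rcons_cat /= sorted_cat_cons.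
case/andP=> _; case: s2 => [|z s2] /= /andP[/eqP -> _].
  by rewrite mem_cat !inE eqxx !orbT.
by rewrite mem_cat !inE eqxx !orbT.
Qed.

(** Along a path that leaves [U] no cycle closes: a cycle through a vertex of the
    path would contain its endpoint. *)
Lemma map_weight_exit (U : {fset V}) h s y : path_in [in U] s -> y \notin U ->
    sorted (frel h) (rcons s y) ->
  map_weight U h = map_weight (fset_minus U s) h.
Proof.
move=> /and3P[_ us /allP sU] yU hs; rewrite (@map_weight_split _ _ s) //; last first.
  move=> w ws; have := fpath_next hs ws; rewrite mem_rcons inE => /orP[/eqP->|//].
  by rewrite (negbTE yU).
rewrite big_seq big1 ?mul1r // => z zs; apply: cycle_share1 => c.
apply/negP => /and4P[hc uc zc /allP cU]; move: yU; rewrite [y \in U]cU //.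
move: hs; case/splitPr: zs => s1 s2; rewrite rcons_cat /= sorted_cat_cons.
case/andP=> _ ps2; apply: (fpath_closed ps2 zc); last by rewrite mem_rcons mem_head.
by move=> w _; exact: fcycle_step.
Qed.

(** A path closed at [y] contributes exactly the loop from [y] to itself: a cycle
    through an earlier vertex would be absorbed in that loop. *)
Lemma map_weight_loop (U : {fset V}) h s y : path_in [in U] s -> y \in s ->
    sorted (frel h) (rcons s y) ->
  map_weight U h = lw (loop_at s y) * map_weight (fset_minus U s) h.
Proof.
move=> /and3P[_ us /allP sU] ys hs; rewrite (@map_weight_split _ _ s) //; last first.
  by move=> w ws _; have := fpath_next hs ws; rewrite mem_rcons inE => /orP[/eqP->|].
congr (_ * _); rewrite /loop_at.
move: us sU hs; case/splitPr: ys => s1 s2 us sU hs.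
have ys1 : y \notin s1.
  by move: us; rewrite cat_uniq => /and3P[_ /norP[]].
have -> : drop (index y (s1 ++ y :: s2)) (s1 ++ y :: s2) = y :: s2.
  by rewrite index_cat (negbTE ys1) /= eqxx addn0 drop_size_cat.
have hc : fcycle h (y :: s2).
  by move: hs; rewrite rcons_cat /= sorted_cat_cons => /andP[].
have uc : uniq (y :: s2) by move: us; rewrite cat_uniq => /and3P[].
rewrite big_cat /= [X in X * _]big_seq [X in X * _]big1 ?mul1r; last first.
  move=> z zs1; apply: cycle_share1 => c; apply/negP => /and4P[hc' _ zc _].
  have yc : y \in c.
    move: hs; case/splitPr: zs1 => a b; rewrite -catA /= rcons_cat /= sorted_cat_cons.
    case/andP=> _ pb; apply: (fpath_closed pb zc).
      by move=> w _; exact: fcycle_step.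
    by rewrite mem_rcons mem_head.
  have := fcycle_closed hc' yc (mem_head y s2) (fun w _ => @fcycle_step _ _ w hc) zc.
  by move: us; rewrite cat_uniq => /and3P[_ /hasPn no _] /no; rewrite /= zs1.
pose n := size (y :: s2).
transitivity (\prod_(z <- y :: s2) (lw (y :: s2) `^ n%:R^-1)).
  apply: eq_big_seq => z zc; apply: cycle_shareE.
  rewrite /cycle_through hc uc zc; apply/allP => w wc; apply: sU.
  by rewrite mem_cat wc orbT.
rewrite big_const_seq count_predT iter_mulr_1 -powR_mulrn ?powR_ge0 // -powRrM.
by rewrite mulVf ?pnatr_eq0 // powRr1 // loop_weight_ge0.
Qed.

(** ** Exploring a successor map from a vertex *)

Definition follow (g : V -> V) (t : seq V) : V -> V :=
  fun z => if ((index z t).+1 < size t)%N then nth z t (index z t).+1 else g z.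

Lemma follow1 g x : follow g [:: x] = g.
Proof. by apply/funext => z; rewrite /follow. Qed.

(** Choosing the successor of the endpoint of the explored path extends it. *)
Lemma upd_follow g s v y : uniq (rcons s v) ->
  upd (follow g (rcons s v)) v y = follow g (rcons (rcons s v) y).
Proof.
move=> us; have vs : v \notin s by move: us; rewrite rcons_uniq => /andP[].
apply/funext => z; rewrite /upd /follow !size_rcons.
have [->|zv] /= := eqVneq z v.
  have -> : index v (rcons (rcons s v) y) = size s.
    by rewrite -!cats1 -catA index_cat (negbTE vs) /= eqxx addn0.
  by rewrite ltnSn nth_rcons size_rcons ltnn eqxx.
case zs : (z \in s).
  have iz : (index z s < size s)%N by rewrite index_mem.
  have -> : index z (rcons (rcons s v) y) = index z s.
    by rewrite -!cats1 -catA index_cat zs.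
  have -> : index z (rcons s v) = index z s by rewrite -cats1 index_cat zs.
  by rewrite !ltnS iz (ltnW iz) [in RHS]nth_rcons size_rcons ltnS iz.
have -> : index z (rcons s v) = (size s).+1.
  by rewrite -cats1 index_cat zs /= eq_sym (negbTE zv) addn1.
rewrite [in LHS]ltnNge leqnSn /=.
rewrite ifF //; apply/negbTE; rewrite -leqNgt -!cats1 -catA index_cat zs /=.
by rewrite [v == z]eq_sym (negbTE zv) addnS !ltnS leq_addr.
Qed.

Lemma sorted_follow g h s y : uniq s ->
    (forall w, w \in s -> h w = follow g (rcons s y) w) ->
  sorted (frel h) (rcons s y).
Proof.
move=> us hg; apply/(sortedP x0) => i; rewrite size_rcons ltnS => is_.
have ni : nth x0 (rcons s y) i = nth x0 s i by rewrite nth_rcons is_.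
rewrite /= ni hg ?mem_nth // /follow size_rcons.
have -> : index (nth x0 s i) (rcons s y) = i.
  by rewrite -cats1 index_cat mem_nth // index_uniq.
by rewrite ltnS is_; apply/eqP; apply: set_nth_default; rewrite size_rcons ltnS.
Qed.

Lemma fset_minus_rcons (U : {fset V}) t y : (y \notin U) || (y \in t) ->
  fset_minus U (rcons t y) = fset_minus U t.
Proof.
move=> Hy; apply/fsetP => z; rewrite !in_fset_minus mem_rcons inE negb_or.
case: (eqVneq z y) Hy => //= ->.
by case: (y \in U) => //= ->.
Qed.

Definition weighted_sum (U : {fset V}) (phi : (V -> V) -> R) (g : V -> V) : R :=
  map_sum U (fun h => map_weight U h * phi h) g.

(** Summing over successor maps by exploring the orbit of a starting vertex:
    the orbit runs through a self-avoiding path until it leaves [U] or closes a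
    cycle, and the map is arbitrary on the vertices not explored. *)
Lemma weighted_sum_explore (U : {fset V}) phi g s v : path_in [in U] (rcons s v) ->
  map_sum (fset_minus U s) (fun h => map_weight U h * phi h) (follow g (rcons s v))
  = saw_sum U (fun t => weighted_sum (fset_minus U t) phi (follow g t)) (rcons s v).
Proof.
have [n] := ubnP (#|` U| - size s)%N; elim: n s v => // n IHn s v ltn svU.
have /and3P[_ usv /allP aU] := svU.
have vs : v \notin s by move: usv; rewrite rcons_uniq => /andP[].
have vU : v \in U by apply: (aU v); rewrite mem_rcons mem_head.
have szU : (size s < #|` U|)%N.
  by rewrite -(size_rcons s v); apply: uniq_leq_size => // z /aU.
have pU : perm_eq (fset_minus U s) (v :: fset_minus U (rcons s v)).
  apply: uniq_perm; first exact: fset_uniq.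
    apply/andP; split; last exact: fset_uniq.
    have : v \notin fset_minus U (rcons s v) by rewrite in_fset_minus mem_rcons mem_head andbF.
    by [].
  move=> z; rewrite in_cons !in_fset_minus mem_rcons in_cons negb_or.
  by case: eqVneq => [->|]; rewrite ?vU ?vs.
rewrite (map_sum_perm _ _ (fset_uniq _) pU) saw_sumE //= /lerw_mean last_rcons.
apply: eq_next_mean => y _; rewrite upd_follow //.
have sweight c : (forall h, sorted (frel h) (rcons (rcons s v) y) ->
     map_weight U h = c * map_weight (fset_minus U (rcons s v)) h) ->
   map_sum (fset_minus U (rcons s v)) (fun h => map_weight U h * phi h)
     (follow g (rcons (rcons s v) y))
   = c * map_sum (fset_minus U (rcons s v))
       (fun h => map_weight (fset_minus U (rcons s v)) h * phi h)
       (follow g (rcons (rcons s v) y)).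
  move=> hc; rewrite -map_sumZ; apply: eq_map_sum => h hg; rewrite hc ?mulrA //.
  apply: (sorted_follow usv (g := g)) => w ws; apply: hg.
  by rewrite in_fset_minus ws andbF.
case: ifPn => yU; last first.
  rewrite (sweight 1) ?mul1r => [|h hs]; last by rewrite mul1r; exact: map_weight_exit hs.
  by rewrite /weighted_sum (@fset_minus_rcons _ _ y) ?yU.
case: ifPn => ysv; last first.
  apply: IHn; last exact: path_in_rcons.
  by rewrite size_rcons; lia.
rewrite mulr0 addr0 (sweight (lw (loop_at (rcons s v) y))) => [|h hs].
  by rewrite /weighted_sum (@fset_minus_rcons _ _ y) ?ysv ?orbT.
exact: map_weight_loop.
Qed.

Definition partition_function (U : {fset V}) : R := weighted_sum U (fun=> 1) id.

Lemma partition_function_base (U : {fset V}) g :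
  weighted_sum U (fun=> 1) g = partition_function U.
Proof.
apply: map_sum_base => h h' hh'; rewrite (@eq_map_weight U h h') // => w wU.
by apply: hh'; left.
Qed.

Lemma weighted_sum_saw_sum (U : {fset V}) phi g x : x \in U ->
  weighted_sum U phi g
  = saw_sum U (fun t => weighted_sum (fset_minus U t) phi (follow g t)) [:: x].
Proof.
move=> xU; have := @weighted_sum_explore U phi g [::] x (path_in1 xU).
rewrite follow1 => <-; congr (map_sum _ _ _).
by congr enum_fset; apply/fsetP => z; rewrite in_fset_minus andbT.
Qed.

Lemma partition_functionE (U : {fset V}) x : x \in U ->
  partition_function U = saw_sum U (fun t => partition_function (fset_minus U t)) [:: x].
Proof.
move=> xU; rewrite {1}/partition_function (weighted_sum_saw_sum _ _ xU).
by apply: eq_saw_sum => t; exact: partition_function_base.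
Qed.

Lemma weighted_sum_ge0 (U : {fset V}) phi g : (forall h, 0 <= phi h) ->
  0 <= weighted_sum U phi g.
Proof.
by move=> phi0; apply: map_sum_ge0 => h; rewrite mulr_ge0 ?map_weight_ge0.
Qed.

(** An exit path from [x] contributes a positive term to the exploration. *)
Lemma partition_function_gt0 (U : {fset V}) : 0 < partition_function U.
Proof.
have [n] := ubnP #|` U|; elim: n U => // n IHn U ltUn.
have [->|[x xU]] := fset_0Vmem U.
  by rewrite /partition_function /weighted_sum /map_weight /= big_nil mulr1.
have [ys [y [pys us aU yU]]] := Hexit xU.
rewrite (partition_functionE xU).
have psi0 t : 0 <= partition_function (fset_minus U t).
  by apply: weighted_sum_ge0.
apply: (saw_sum_gt0 (path_in1 xU) psi0 pys us aU yU).
apply: IHn; rewrite -ltnS; apply: leq_trans ltUn; rewrite ltnS.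
rewrite fset_minus_cons; apply: leq_ltn_trans (fproper_ltn_card (fproperD1 xU)).
by apply: uniq_leq_size => [|z]; rewrite ?fset_uniq // in_fset_minus => /andP[].
Qed.

Lemma weighted_ratio_unit (U : {fset V}) phi g : (forall h, 0 <= phi h <= 1) ->
  0 <= weighted_sum U phi g / partition_function U <= 1.
Proof.
move=> phi01; have Z0 := partition_function_gt0 U.
rewrite divr_ge0 ?weighted_sum_ge0 ?(ltW Z0) //=; last by move=> h; case/andP: (phi01 h).
rewrite ler_pdivrMr // mul1r -(partition_function_base U g).
apply: le_map_sum => h; apply: ler_wpM2l; first exact: map_weight_ge0.
by case/andP: (phi01 h).
Qed.

(** What remains to be summed after the walk from [x] ended is again a ratio of
    sums over successor maps, in the smaller domain; the walk averages these
    ratios to the one in [U], whatever [x] is. *)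
Lemma payoff_weighted_sum (U : {fset V}) phi g x : x \in U ->
    (forall h, 0 <= phi h <= 1) ->
  payoff [in U] (fun t => weighted_sum (fset_minus U t) phi (follow g t)
                          / partition_function (fset_minus U t)) [:: x]
  = weighted_sum U phi g / partition_function U.
Proof.
move=> xU phi01; apply: (mulIf (lt0r_neq0 (partition_function_gt0 U))).
rewrite payoff_saw_sum //; last by move=> t; exact: weighted_ratio_unit.
  rewrite divfK ?lt0r_neq0 ?partition_function_gt0 // (weighted_sum_saw_sum _ _ xU).
  by apply: eq_saw_sum => t; rewrite mulrC divfK // lt0r_neq0 ?partition_function_gt0.
by move=> U' x' x'U'; exact: partition_functionE.
Qed.

(** * The loop assumption forces the walk to end *)

Lemma path_srw_prob v s : 0 < srw_prob R e v s -> path e v s.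
Proof.
elim: s v => //= u s IHs v; rewrite /srw_step; case: ifP => [_|_].
  rewrite pmulr_rgt0 ?invr_gt0 ?ltr0n ?degree_gt0 //; exact: IHs.
by rewrite mul0r ltxx.
Qed.

(** Along fresh vertices nothing can be erased, so a bound at the end of the walk
    is inherited at its start with the probability of the walk. *)
Lemma null_harmonic_fresh (U : {pred V}) h H b zs t : harmonic U (fun=> 0) h ->
    (forall t, path_in U t -> 0 <= h t <= H) ->
    path_in U t -> all [in U] zs -> uniq (t ++ zs) -> path e (last x0 t) zs ->
    h (t ++ zs) <= b ->
  h t <= H - srw_prob R e (last x0 t) zs * (H - b).
Proof.
move=> Hh h0H; elim: zs t => [|z zs IHzs] t tU /=.
  by rewrite cats0 mul1r opprB addrC subrK.
move=> /andP[zU aU] ut /andP[ez pz] hb; rewrite Hh //.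
have E (a q' : R) : a - q' * (a - (a - srw_prob R e z zs * (a - b)))
    = a - q' * srw_prob R e z zs * (a - b) by ring.
rewrite -E; apply: next_mean_le_at ez _ _ => [w _|]; first exact: null_step_le.
have zt : z \notin t by apply: contraTN ut => zt; rewrite cat_uniq /= zt andbF.
rewrite [z \in U]zU (negbTE zt).
have := IHzs _ (path_in_rcons tU zU zt); rewrite last_rcons cat_rcons.
exact.
Qed.

(** A fresh cycle closed by the walk is the loop that is tested, hence it is
    kept with probability its weight. *)
Lemma null_harmonic_cycle h H c t : harmonic predT (fun=> 0) h ->
    (forall t, path_in predT t -> 0 <= h t <= H) -> path_in predT t ->
    c != [::] -> uniq (t ++ c) -> path e (last x0 t) (closed_seq c) ->
  h t <= H - srw_prob R e (last x0 t) (closed_seq c) * lw c * H.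
Proof.
move=> Hh h0H tT; case: c => // y c _ ut.
rewrite /closed_seq -cats1 cat_path /= andbT => /andP[pc ey].
have yt : y \notin t by apply: contraTN ut => yt; rewrite cat_uniq /= yt andbF.
have tcT : path_in predT (t ++ y :: c).
  by rewrite /path_in ut all_predT andbT; case: (t).
have loopE : loop_at (t ++ y :: c) y = y :: c.
  by rewrite /loop_at index_cat (negbTE yt) /= eqxx addn0 drop_size_cat.
have ytc : y \in t ++ y :: c by rewrite mem_cat mem_head orbT.
have hb : h (t ++ y :: c) <= H - q (last y c) y * (lw (y :: c) * H).
  rewrite Hh // (_ : lw _ * H = H - (1 - lw (y :: c)) * H); last by ring.
  have -> : last y c = last x0 (t ++ y :: c) by rewrite last_cat.
  apply: next_mean_le_at => [|w _|]; first by rewrite last_cat.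
    exact: (null_step_le w h0H tcT).
  rewrite ytc loopE mulr0 add0r ler_wpM2l ?onem_loop_weight_ge0 //.
  by case/andP: (h0H _ (path_in_erased tcT ytc)).
have aT : all [in predT] (y :: c) by apply/allP.
have := null_harmonic_fresh Hh h0H tT aT ut pc hb.
congr (_ <= _ - _); rewrite srw_prob_cat /=; ring.
Qed.

Lemma exhaustion_subset (G : nat -> {fset V}) (l : seq V) : exhaustion e G ->
  exists n, {subset l <= G n}.
Proof.
case=> Gmono _ Gcover.
have mono m n : (m <= n)%N -> {subset G m <= G n}.
  elim: n => [|n IHn]; first by rewrite leqn0 => /eqP ->.
  rewrite leq_eqVlt => /orP[/eqP->//|/IHn sub] z /sub.
  exact: (fsubsetP (Gmono n)).
elim: l => [|x l [n IHn]]; first by exists 0%N.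
have [m _ xm] : (\bigcup_n [set` G n]) x by rewrite Gcover.
exists (maxn m n) => z; rewrite inE => /orP[/eqP->|/IHn].
  exact: (mono m) (leq_maxl _ _) x xm.
exact: (mono n) (leq_maxr _ _) z.
Qed.

(** In a ball of the exhaustion the walk ends or reaches the boundary, and from
    there it roots with probability at least [alpha * beta] before it can meet
    its own path.  Hence the largest probability of never ending is at most
    [1 - alpha * beta] times itself. *)
Lemma transient_loop_assumption (G : nat -> {fset V}) : exhaustion e G ->
  loop_assumption e G p -> transient predT.
Proof.
move=> HG [alpha [beta [a0 b0 loops]]].
pose eps : R := Num.min 1 (alpha * beta).
have eps0 : 0 < eps by rewrite lt_min ltr01 mulr_gt0.
apply: transient_never_ends; apply: (contraction_null eps0).
  by move=> s sT; exact: never_ends_unit.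
move=> H hH s sT; pose h := never_ends predT.
have Hh : harmonic predT (fun=> 0) h by exact: never_ends_harmonic.
have h0H t : path_in predT t -> 0 <= h t <= H.
  by move=> tT; rewrite hH // andbT; case/andP: (never_ends_unit tT).
have H0 : 0 <= H by case/andP: (h0H s sT); exact: le_trans.
(* All neighbours of [s] are in [G n], so [s] avoids the boundary. *)
have [n sub] := exhaustion_subset (s ++ flatten [seq nbrs z | z <- s]) HG.
pose U : {fset V} := [fset z in G n | ~~ `[< boundary e (G n) z >]]%fset.
have inU z : (z \in U) = (z \in G n) && ~~ `[< boundary e (G n) z >] by rewrite !inE.
have sU : path_in [in U] s.
  case/and3P: sT => s0 us _; rewrite /path_in s0 us; apply/allP => z zs /=.
  rewrite inU sub ?mem_cat ?zs //=; apply/asboolP => -[_ [u ezu]]; apply/negP/negPn.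
  apply: sub; rewrite mem_cat; apply/orP; right; apply/flattenP.
  by exists (nbrs z); [exact: map_f | rewrite mem_nbrs].
(* The walk stopped on leaving [U]: a final path ends in [U] when it is rooted. *)
pose f t := if last x0 t \in U then 0 else H - eps * H.
have K0 : 0 <= H - eps * H by rewrite subr_ge0 ler_piMl // ge_min lexx.
have fK t : f t <= H - eps * H by rewrite /f; case: ifP.
have subh t : path_in [in U] t -> h t <= lerw_mean [in U] f h h t.
  move=> tU; have tT : path_in predT t.
    by case/and3P: tU => t0 ut _; rewrite /path_in t0 ut all_predT.
  rewrite Hh //; apply: le_next_mean => u eu.
  rewrite -[u \in [in U]]/(u \in U) -[u \in predT]/true.
  have [uU|uU] := boolP (u \in U).
    by case: ifP => // _; rewrite /f last_rcons uU.
  have utn : u \notin t.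
    by apply: contra uU => ut; case/and3P: tU => _ _ /allP; apply.
  rewrite (negbTE utn) /f last_rcons (negbTE uU).
  have := path_in_last tU; rewrite /= inU => /andP[lG /asboolP nb].
  have uG : u \in G n.
    by apply/negPn/negP => uG; apply: nb; split=> //; exists u.
  have bu : boundary e (G n) u.
    by move: uU; rewrite inU uG /= negbK => /asboolP.
  have [c [cyc fresh ac bc]] := loops n u bu.
  have rT : path_in predT (rcons t u) by exact: path_in_rcons.
  have srw0 : 0 < srw_prob R e u (closed_seq c) by exact: lt_trans bc.
  have ut : uniq (rcons t u ++ c).
    rewrite cat_uniq; apply/and3P; split; [by case/and3P: rT| |by case/and3P: cyc].
    apply/hasPn => z /fresh[_ zG _] /=; apply: contra zG.
    rewrite mem_rcons inE => /orP[/eqP->//|zt].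
    by case/and3P: tU => _ _ /allP/(_ z zt); rewrite /= inU => /andP[].
  have c0 : c != [::] by case: (c) cyc.
  have := null_harmonic_cycle Hh h0H rT c0 ut; rewrite last_rcons.
  move=> /(_ (path_srw_prob srw0)) hle; apply: le_trans hle _.
  rewrite lerB // ler_wpM2r // ge_min; apply/orP; right.
  by rewrite /loop_weight cyc mulrC; apply: ler_pM => //; apply: ltW.
have key k : h s <= (H - eps * H) + H * survival [in U] k s.
  apply: le_trans (subharmonic_le k sU subh (M := H) _) _.
    move=> t tU; have tT : path_in predT t.
      by case/and3P: tU => t0 ut _; rewrite /path_in t0 ut all_predT.
    by case/andP: (h0H t tT).
  by rewrite lerD2r; exact: payoff_within_le.
have lim : (H - eps * H) + H * survival [in U] k s @[k --> \oo] --> H - eps * H + H * 0.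
  by apply: cvgD; [exact: cvg_cst | apply: cvgMr; exact: transient_fset].
rewrite mulr0 addr0 in lim; rewrite -(cvg_lim _ lim) //.
by apply: limr_ge; [exact: cvgP lim | exact: nearW].
Qed.

End Harmonic.

(** * Pathwise comparison of the algorithm with a finite domain *)

Section Pathwise.
Variables (R : realType) (V : countType) (e : rel V) (p : seq V -> R).

Local Notation lw := (loop_weight e p).
Local Notation lerw := (lerw e p).
Local Notation ending_time := (ending_time e p).
Local Notation lerw_final := (lerw_final e p).

Lemma first_timeP (Q : nat -> Prop) T :
  first_time Q = Some T <-> Q T /\ forall i, (i < T)%N -> ~ Q i.
Proof.
rewrite /first_time; case: pselect => [ex|no]; last first.
  by split=> // -[QT _]; case: no; exists T; apply/asboolP.
case: ex_minnP => m /asboolP Qm minm; split=> [[<-]|[QT noT]].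
  split=> // i im /asboolP Qi; move: (minm _ Qi).
  by rewrite leqNgt im.
congr Some; apply/eqP; rewrite eqn_leq minm ?asboolT //= leqNgt.
by apply/negP => /noT.
Qed.

Lemma first_time_none (Q : nat -> Prop) : first_time Q = None -> forall i, ~ Q i.
Proof.
rewrite /first_time; case: pselect => // no _ i Qi.
by case: no; exists i; apply/asboolP.
Qed.

Definition has_ended (W : set V) X Y (n : nat) : Prop :=
  is_rooted (lerw X Y n) \/ W (X n).

Lemma ending_timeE W X Y : ending_time W X Y = first_time (has_ended W X Y).
Proof.
rewrite /ending_time /Defs.ending_time /rooting_time /hitting_time.
case hr : (first_time (fun n => is_true _)) => [r|];
  case hh : (first_time (fun n => W _)) => [m|] /=; apply/esym.
- move/first_timeP: hr => [r1 r2]; move/first_timeP: hh => [m1 m2].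
  apply/first_timeP; split; last first.
    move=> i; rewrite leq_min => /andP[ir im] [|]; [exact: r2|exact: m2].
  by rewrite /has_ended; case: (leqP r m) => _; [left|right].
- move/first_timeP: hr => [r1 r2]; apply/first_timeP; split; first by left.
  by move=> i ir [|]; [exact: r2|exact: (first_time_none hh)].
- move/first_timeP: hh => [m1 m2]; apply/first_timeP; split; first by right.
  by move=> i im [|]; [exact: (first_time_none hr)|exact: m2].
- case he : (first_time _) => [T|] //; move/first_timeP: he => -[[rT|WT] _].
    by have := first_time_none hr rT.
  by have := first_time_none hh WT.
Qed.

Lemma ending_timeP W X Y T : ending_time W X Y = Some T <->
  has_ended W X Y T /\ forall i, (i < T)%N -> ~ has_ended W X Y i.
Proof. by rewrite ending_timeE; exact: first_timeP. Qed.

(** The walk has ended by its rooting time, so only the boundary vertices visited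
    until then matter. *)
Lemma eq_ending_time W W' X Y T : is_rooted (lerw X Y T) ->
    (forall i, (i <= T)%N -> W (X i) <-> W' (X i)) ->
  exists T', ending_time W X Y = Some T' /\ ending_time W' X Y = Some T'.
Proof.
move=> rT WW'.
have exT : exists n, `[< has_ended W X Y n >] by exists T; apply/asboolP; left.
have [m /asboolP endm minm] := ex_minnP exT.
have mT : (m <= T)%N by apply: minm; apply/asboolP; left.
exists m; split; apply/ending_timeP; split=> //.
- by move=> i im /asboolP/minm; rewrite leqNgt im.
- by case: endm => [?|?]; [left|right; apply/WW'].
- move=> i im; have iT : (i <= T)%N by apply: leq_trans mT; exact: ltnW.
  move=> endi; suff /asboolP/minm : has_ended W X Y i by rewrite leqNgt im.
  by case: endi => [?|?]; [left|right; apply/(WW' _ iT)].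
Qed.

Lemma lerw_walking X Y m s : lerw X Y m = Walking s ->
  [/\ s != [::], uniq s & forall z, z \in s -> exists2 i, (i <= m)%N & z = X i].
Proof.
elim: m s => [|m IHm] s /=.
  by case=> <-; split=> // z; rewrite inE => /eqP ->; exists 0%N.
case hS : (lerw X Y m) => [s'|s'] //=; have [s'0 us' s'X] := IHm _ hS.
have lift z : z \in s' -> exists2 i, (i <= m.+1)%N & z = X i.
  by case/s'X => i im ->; exists i => //; exact: leqW.
case: ifPn => us; last case: ifP => // _.
  case=> <-; rewrite rcons_uniq us us'; split=> //; first by case: (s').
  by move=> z; rewrite mem_rcons inE => /orP[/eqP->|/lift//]; exists m.+1.
case=> <-; rewrite take_uniq //; split=> //; last by move=> z /mem_take/lift.
by case: (s') us.
Qed.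

Lemma not_rooted X Y m : ~~ is_rooted (lerw X Y m) -> {s | lerw X Y m = Walking s}.
Proof. by case: (lerw X Y m) => // s _; exists s. Qed.

Lemma rooted_stays X Y i m : (i <= m)%N -> is_rooted (lerw X Y i) ->
  is_rooted (lerw X Y m).
Proof.
move=> + ri; elim: m => [|m IHm]; first by rewrite leqn0 => /eqP <-.
rewrite leq_eqVlt => /orP[/eqP <-//|/IHm rm] /=.
by case: (lerw X Y m) rm.
Qed.

(** A final path meets the boundary at its endpoint only, and otherwise closes a
    kept loop there; a loop erased at the hitting time would have met the boundary
    before. *)
Lemma lerw_final_spec W X Y : lerw_final W X Y != [::] ->
  exists s y, [/\ lerw_final W X Y = rcons s y, uniq s,
     forall z, z \in s -> ~ W z & W y \/ y \in s].
Proof.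
rewrite /lerw_final /Defs.lerw_final; case hT : (ending_time W X Y) => [T|] // _.
move/ending_timeP: hT => [endT noT]; case: T endT noT => [|T] endT noT.
  by exists [::], (X 0%N); split=> //; case: endT => // ?; left.
have nr : ~~ is_rooted (lerw X Y T).
  by apply/negP => rT; apply: (noT T) => //; left.
have [s hs] := not_rooted nr; have [s0 us sX] := lerw_walking hs.
have sW z : z \in s -> ~ W z.
  by case/sX => i iT -> Wz; apply: (noT i) => //; right.
move: endT; rewrite /has_ended /= hs /=; case: ifPn => Xs.
  by case=> // WX; exists s, (X T.+1); split=> //; left.
move: Xs; rewrite negbK => Xs; case: ifP => _ /=.
  by exists s, (X T.+1); split=> //; right.
by case=> // /(sW _ Xs).
Qed.

(** A description of the ending of the walk that consumes one step at a time, in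
    the same way as [payoff_within] does, for use with cylinder events. *)
Fixpoint ends_within (U : {pred V}) (X : nat -> V) (Y : nat -> R) (n m : nat)
    (s : seq V) : option (seq V) :=
  if n is n'.+1 then
    let u := X m.+1 in
    if u \in U then
      if u \in s then
        if Y m.+1 <= lw (loop_at s u) then Some (rcons s u)
        else ends_within U X Y n' m.+1 (erased_at s u)
      else ends_within U X Y n' m.+1 (rcons s u)
    else Some (rcons s u)
  else None.

Lemma ends_within_neq0 (U : {pred V}) X Y n m s t :
  ends_within U X Y n m s = Some t -> t != [::].
Proof.
elim: n m s => //= n IHn m s; have r0 u : rcons s u != [::] by case: (s).
case: ifP => _; last by case=> <-.
case: ifP => _; last exact: IHn.
by case: ifP => _; [case=> <-|exact: IHn].
Qed.

Lemma ends_withinS (U : {pred V}) X Y n m s t :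
  ends_within U X Y n m s = Some t -> ends_within U X Y n.+1 m s = Some t.
Proof.
elim: n m s => // n IHn m s; rewrite [ends_within _ _ _ n.+2 _ _]/=.
rewrite [ends_within _ _ _ n.+1 _ _]/=.
case: ifP => // _; case: ifP => _; last exact: IHn.
by case: ifP => // _; exact: IHn.
Qed.

Lemma ends_within_final (U : {pred V}) X Y n m s t : lerw X Y m = Walking s ->
    (forall i, (i <= m)%N -> X i \in U) -> ends_within U X Y n m s = Some t ->
  exists2 T, ending_time [set z | z \notin U] X Y = Some T & lerw_trace (lerw X Y T) = t.
Proof.
elim: n m s => //= n IHn m s hs XU.
have noend i : (i <= m)%N -> ~ has_ended [set z | z \notin U] X Y i.
  move=> im; rewrite /has_ended /= XU //; case=> //.
  by move/(rooted_stays im); rewrite hs.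
have endS : has_ended [set z | z \notin U] X Y m.+1 -> 
    ending_time [set z | z \notin U] X Y = Some m.+1.
  by move=> ?; apply/ending_timeP.
have stepE : lerw X Y m.+1 = lerw_step e p (Walking s) (X m.+1) (Y m.+1) by rewrite /= hs.
have XUS : X m.+1 \in U -> forall i, (i <= m.+1)%N -> X i \in U.
  by move=> XmU i; rewrite leq_eqVlt => /orP[/eqP->//|]; exact: XU.
case: ifPn => uU; last first.
  case=> <-; exists m.+1; first by apply: endS => //; right.
  have us : X m.+1 \notin s.
    apply: contra uU => us; have [_ _ /(_ _ us) [i im ->]] := lerw_walking hs.
    exact: XU.
  by rewrite stepE /= us.
case: ifPn => us; last first.
  by apply: IHn => //; [rewrite stepE /= us | exact: XUS].
case: ifPn => yl; last first.
  by apply: IHn => //; [rewrite stepE /= us (negbTE yl) | exact: XUS].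
case=> <-; have rE : lerw X Y m.+1 = Rooted (rcons s (X m.+1)) by rewrite stepE /= us yl.
by exists m.+1; [apply: endS => //; left; rewrite rE | rewrite rE].
Qed.

Lemma final_ends_within (U : {pred V}) X Y m s T : lerw X Y m = Walking s ->
    (forall i, (i <= m)%N -> X i \in U) ->
    ending_time [set z | z \notin U] X Y = Some T -> (m < T)%N ->
  ends_within U X Y (T - m) m s = Some (lerw_trace (lerw X Y T)).
Proof.
move=> + + /ending_timeP[endT noT] mT.
have [n] : {n | T = m + n.+1}%N by exists (T - m).-1; lia.
elim: n m s mT => [|n IHn] m s mT Tn hs XU.
  have -> : (T - m = 1)%N by lia.
  have TS : T = m.+1 by lia.
  move: endT; rewrite TS /has_ended /= hs /=.
  have [XmU|XmU] := boolP (X m.+1 \in U); last first.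
    have us : X m.+1 \notin s.
      apply: contra XmU => us; have [_ _ /(_ _ us) [i im ->]] := lerw_walking hs.
      exact: XU.
    by rewrite us.
  have [us|us] /= := boolP (X m.+1 \in s); last by case.
  by rewrite /loop_at; case: (Y m.+1 <= _) => //= -[].
have -> : (T - m = (T - m.+1).+1)%N by lia.
have SmT : (m.+1 < T)%N by lia.
have := noT _ SmT; rewrite /has_ended /= hs /=.
have [XmU|XmU] := boolP (X m.+1 \in U); last by move=> no; case: no; right.
have XUS : forall i, (i <= m.+1)%N -> X i \in U.
  by move=> i; rewrite leq_eqVlt => /orP[/eqP->//|]; exact: XU.
have [us|us] /= := boolP (X m.+1 \in s); last first.
  move=> _; apply: IHn => //; [lia | by rewrite /= hs /= us].
rewrite {1}/loop_at; case: ifPn => yl; first by move=> no; case: no; left.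
move=> _; apply: IHn => //; [lia | by rewrite /= hs /= us (negbTE yl)].
Qed.

Lemma lerw_final_ends_within (U : {pred V}) X Y t : X 0%N \in U -> t != [::] ->
  lerw_final [set z | z \notin U] X Y = t <->
  exists n, ends_within U X Y n 0 [:: X 0%N] = Some t.
Proof.
move=> X0 t0; have XU i : (i <= 0)%N -> X i \in U by rewrite leqn0 => /eqP->.
split=> [|[n]]; last first.
  case/(ends_within_final (erefl : lerw X Y 0 = _) XU) => T hT <-.
  by rewrite /lerw_final /Defs.lerw_final hT.
rewrite /lerw_final /Defs.lerw_final; case hT : (ending_time _ X Y) => [T|] /=; last first.
  by move=> tE; rewrite -tE in t0.
move=> <-; exists T; rewrite -[T in ends_within _ _ _ T]subn0.
apply: final_ends_within => //; rewrite lt0n; apply/eqP => T0.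
by move/ending_timeP: hT; rewrite T0 => -[[]]//=; rewrite X0.
Qed.


Lemma trace_edges_rcons (g : V -> V) s y A : uniq s ->
  A \in trace_edges (rcons s y)
  <-> exists2 z, z \in s & A = [fset z; follow g (rcons s y) z]%fset.
Proof.
move=> us; have szE : size (zip (rcons s y) (behead (rcons s y))) = size s.
  by rewrite size_zip size_behead size_rcons /=; apply/minn_idPr.
have nthE i : (i < size s)%N ->
    nth (y, y) (zip (rcons s y) (behead (rcons s y))) i
    = (nth y s i, follow g (rcons s y) (nth y s i)).
  move=> is_; rewrite nth_zip_cond szE is_ nth_behead nth_rcons is_.
  rewrite /follow size_rcons.
  have -> : index (nth y s i) (rcons s y) = i.
    by rewrite -cats1 index_cat mem_nth // index_uniq.
  by rewrite ltnS is_; congr pair; apply: set_nth_default; rewrite size_rcons ltnS.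
rewrite /trace_edges; split=> [/mapP[q /(nthP (y, y))[i]]|[z zs ->]].
  rewrite szE => is_ <-; rewrite nthE //= => ->.
  by exists (nth y s i) => //; exact: mem_nth.
have is_ : (index z s < size s)%N by rewrite index_mem.
apply/mapP; exists (z, follow g (rcons s y) z) => //.
by apply/(nthP (y, y)); exists (index z s); rewrite ?szE // nthE // nth_index.
Qed.

Lemma follow_out (g : V -> V) s y z : z \notin s -> follow g (rcons s y) z = g z.
Proof.
move=> zs; rewrite /follow size_rcons -cats1 index_cat (negbTE zs) ltnS.
by rewrite -ltn_subRL subnn.
Qed.

(** The algorithm in the finite domain [U], with everything outside [U] as the
    initial boundary condition.  The state is the set of vertices not yet covered
    and the map sending each covered vertex to its successor. *)
Fixpoint wired_state (X : V -> nat -> V) (Y : V -> nat -> R) (vs : seq V)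
    (U : {fset V}) (g : V -> V) : option ({fset V} * (V -> V)) :=
  if vs is v :: vs' then
    if v \in U then
      let t := lerw_final [set z | z \notin U] (X v) (Y v) in
      if t == [::] then None else wired_state X Y vs' (fset_minus U t) (follow g t)
    else wired_state X Y vs' U g
  else Some (U, g).

Lemma wired_state_cat X Y vs vs' U g : wired_state X Y (vs ++ vs') U g =
  obind (fun Ug => wired_state X Y vs' Ug.1 Ug.2) (wired_state X Y vs U g).
Proof.
elim: vs U g => //= v vs IHvs U g.
by case: ifP => _; rewrite ?IHvs //; case: ifP => _; rewrite ?IHvs.
Qed.

Lemma wired_state_out X Y vs (U : {fset V}) g U' g' z :
  wired_state X Y vs U g = Some (U', g') -> z \notin U -> g' z = g z.
Proof.
elim: vs U g => [|v vs IHvs] U g /=; first by case=> _ <-.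
case: ifP => vU; last exact: IHvs.
case: ifPn => // /lerw_final_spec[s [y [tE us sU _]]] /IHvs IH zU; rewrite tE in IH.
rewrite IH; last by rewrite in_fset_minus (negbTE zU).
by rewrite follow_out //; apply/negP => /sU /=; rewrite zU.
Qed.

Definition has_edge (g : V -> V) (A : {fset V}) : bool :=
  `[< exists2 z, z \in A & A = [fset z; g z]%fset >].

Lemma eq_has_edge g g' (A : {fset V}) : {in A, g =1 g'} -> has_edge g A = has_edge g' A.
Proof.
move=> gg'; apply/asboolP/asboolP => -[z zA AE]; exists z => //; first by rewrite -gg'.
by rewrite gg'.
Qed.

Variables (X : V -> nat -> V) (Y : V -> nat -> R) (phi : nat -> V).
Local Notation F := (forest_upto e p phi X Y).

Lemma forest_upto_mono i j : (i <= j)%N ->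
  (F i).1 `<=` (F j).1 /\ (F i).2 `<=` (F j).2.
Proof.
elim: j => [|j IHj]; first by rewrite leqn0 => /eqP ->; split=> ?.
rewrite leq_eqVlt => /orP[/eqP->|/IHj[V1 E1]] /=; first by split=> ?.
by split=> z ?; left; [exact: V1|exact: E1].
Qed.

(** Each edge added by a walk has an endpoint that was not covered before. *)
Lemma forest_upto_covered k j (a : {fset V}) : (k <= j)%N ->
    (forall z, z \in a -> (F k).1 z) -> (F j).2 a -> (F k).2 a.
Proof.
move=> + ak; elim: j => [|j IHj]; first by rewrite leqn0 => /eqP ->.
rewrite leq_eqVlt => /orP[/eqP->//|]; rewrite ltnS => kj /=; case=> [/(IHj kj)//|].
have [->//|] := eqVneq (lerw_final (F j).1 (X (phi j)) (Y (phi j))) [::].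
move/lerw_final_spec=> [s [y [-> us sF _]]] /=.
move/(trace_edges_rcons id y a us) => [z zs aE].
case: (sF z zs); apply: (proj1 (forest_upto_mono kj)); apply: ak.
by rewrite aE !inE eqxx.
Qed.

Lemma mem_lerw_final W v : lerw_final W (X v) (Y v) != [::] ->
  X v 0%N \in lerw_final W (X v) (Y v).
Proof.
rewrite /lerw_final /Defs.lerw_final; case: ending_time => // T _.
suff: ohead (lerw_trace (lerw (X v) (Y v) T)) = Some (X v 0%N).
  by case: (lerw_trace _) => //= x s [->]; rewrite mem_head.
elim: T => //= T; case: (lerw _ _ T) => [[|x s]|s] //= xs.
by case: ifP => _; [|case: ifP => _].
Qed.

Variable S : {fset V}.

Definition roots_inside (v : V) : Prop := X v 0%N = v /\
  exists T, is_rooted (lerw (X v) (Y v) T) /\ forall i, (i <= T)%N -> X v i \in S.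

Lemma lerw_final_inside v (W W' : set V) : roots_inside v ->
    (forall z, z \in S -> W z <-> W' z) ->
  lerw_final W (X v) (Y v) = lerw_final W' (X v) (Y v) /\
  (lerw_final W (X v) (Y v) != [::] /\ {subset lerw_final W (X v) (Y v) <= S}).
Proof.
move=> [X0 [T [rT XS]]] WW'.
have [T' [hT hT']] : exists T', ending_time W (X v) (Y v) = Some T' /\
    ending_time W' (X v) (Y v) = Some T'.
  by apply: (eq_ending_time rT) => i iT; apply: WW'; exact: XS.
rewrite /lerw_final /Defs.lerw_final hT hT'; split=> //.
have T'T : (T' <= T)%N.
  by rewrite leqNgt; apply/negP => lt; move/ending_timeP: hT => [_ /(_ _ lt)]; apply; left.
have sub n : (n <= T)%N -> lerw_trace (lerw (X v) (Y v) n) != [::] /\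
    {subset lerw_trace (lerw (X v) (Y v) n) <= S}.
  elim: n => [|n IHn] nT /=; first by split=> // z; rewrite inE => /eqP->; exact: XS.
  have [] := IHn (ltnW nT); case: (lerw _ _ n) => [s|s] //= s0 sS.
  have XnS : X v n.+1 \in S by exact: XS.
  have rS : {subset rcons s (X v n.+1) <= S}.
    by move=> z; rewrite mem_rcons inE => /orP[/eqP->|/sS].
  case: ifP => _ /=; first by split=> //; case: (s).
  case: ifP => _ /=; first by split=> //; case: (s).
  by split=> [|z /mem_take/sS//]; case: (s) s0.
exact: sub.
Qed.

(** Walks that root inside [S] are blind to the boundary condition outside [S], so
    the algorithms in the graph and in [S] build the same paths. *)
Lemma wired_state_forest k : (forall j, (j < k)%N -> roots_inside (phi j)) ->
  exists U g, [/\ wired_state X Y [seq phi i | i <- iota 0 k] S id = Some (U, g),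
    forall z, (z \in U) = (z \in S) && ~~ `[< (F k).1 z >],
    (F k).1 `<=` [set` S],
    forall A, (F k).2 A <-> exists2 z, (F k).1 z & A = [fset z; g z]%fset &
    forall j, (j < k)%N -> (F k).1 (phi j)].
Proof.
elim: k => [|k IHk] Hk.
  exists S, id; split=> //= [z|A]; last by split=> // -[].
  by case: asboolP => //=; rewrite andbT.
have [|U [g [HU inU FS FE Fphi]]] := IHk _; first by move=> j jk; apply: Hk; exact: ltnW.
have Hk' := Hk k (ltnSn k).
rewrite -[k.+1]addn1 iotaD map_cat wired_state_cat HU /= add0n addn1 /=.
set Fk := F k in inU FS FE Fphi *; set v := phi k in Hk' *.
have WW z : z \in S -> [set z | z \notin U] z <-> Fk.1 z.
  by move=> zS; rewrite /= inU zS negbK; split=> /asboolP.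
have [tE [t0 tS]] := lerw_final_inside Hk' WW.
have vS : v \in S by have [X0 [T [_ XS]]] := Hk'; rewrite -X0; exact: XS.
case: ifPn => vU; last first.
  have Fv : Fk.1 v by apply/(WW v vS).
  have -> : lerw_final Fk.1 (X v) (Y v) = [:: v].
    rewrite /lerw_final /Defs.lerw_final; have [X0 _] := Hk'.
    have -> : ending_time Fk.1 (X v) (Y v) = Some 0%N.
      by apply/ending_timeP; split=> //; right; rewrite X0.
    by rewrite /= X0.
  exists U, g; split=> //=.
  - move=> z; rewrite inU; congr (_ && ~~ _); apply/asboolP/asboolP => [?|[//|]]; first by left.
    by rewrite /= inE => /eqP ->.
  - by move=> z [/FS//|]; rewrite /= inE => /eqP ->.
  - move=> A; split=> [[/FE[z Fz ->]|//]|[z [Fz|zv] AE]].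
    + by exists z => //; left.
    + by left; apply/FE; exists z.
    + by move: zv; rewrite /= inE => /eqP zv; left; apply/FE; exists z => //; rewrite zv.
  - move=> j; rewrite ltnS leq_eqVlt => /orP[/eqP->|/Fphi]; by left.
rewrite -tE (negbTE t0); set t := lerw_final _ _ _ in tE t0 tS *.
have [s [y [tsy us sU yU]]] := lerw_final_spec t0; rewrite -/t in tsy.
exists (fset_minus U t), (follow g t); split=> //=.
- by move=> z; rewrite in_fset_minus inU -andbA asbool_or negb_or asboolb.
- by move=> z [/FS//|/= /tS].
- move=> A; rewrite tsy; split.
    case=> [/FE[z Fz ->]|/= /(trace_edges_rcons g y A us)[z zs ->]].
      exists z; first by left.
      rewrite follow_out //; apply/negP => zs; apply: (sU z zs).
      by rewrite /= inU; apply/nandP; right; rewrite negbK; apply/asboolP.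
    by exists z => //; right; rewrite /= mem_rcons inE zs orbT.
  case=> z Fz ->; have [zs|zs] := boolP (z \in s).
    by right; apply/(trace_edges_rcons g y _ us); exists z.
  left; apply/FE; rewrite follow_out //; exists z => //.
  case: Fz => //= ; rewrite mem_rcons inE (negbTE zs) orbF => /eqP zy.
  case: yU; rewrite -zy ?(negbTE zs) // => zU; apply/WW => //.
  by apply: tS; rewrite tsy mem_rcons inE zy eqxx.
- move=> j; rewrite ltnS leq_eqVlt => /orP[/eqP->|/Fphi]; last by left.
  by right; have [X0 _] := Hk'; rewrite /= -/v -X0; exact: mem_lerw_final.
Qed.

(** Once the endpoints of [a] are covered, no later walk can decide its status,
    and as long as the walks so far root inside [S] the boundary outside [S] does
    not influence them. *)
Lemma wired_state_has_edge k vs U g (a : {fset V}) :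
    (forall j, (j < k)%N -> roots_inside (phi j)) ->
    (forall z, z \in a -> exists2 j, (j < k)%N & z = phi j) ->
    wired_state X Y ([seq phi i | i <- iota 0 k] ++ vs) S id = Some (U, g) ->
  has_edge g a <-> exists i, (F i).2 a.
Proof.
move=> Hk ak; have [U0 [g0 [HU inU FS FE Fphi]]] := wired_state_forest Hk.
have aF z : z \in a -> (F k).1 z by case/ak => j jk ->; exact: Fphi.
rewrite wired_state_cat HU /= => HU'.
rewrite (@eq_has_edge g g0); last first.
  move=> z za; apply: (wired_state_out HU'); rewrite inU; apply/nandP; right.
  by rewrite negbK; apply/asboolP; exact: aF.
split=> [/asboolP[z za aE]|[i]].
  by exists k; apply/FE; exists z => //; exact: aF.
case: (leqP k i) => [ki /(forest_upto_covered ki aF)|/ltnW ik].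
  by move/FE=> [z Fz aE]; apply/asboolP; exists z => //; rewrite aE !inE eqxx.
move/(proj2 (forest_upto_mono ik))/FE=> [z Fz aE].
by apply/asboolP; exists z => //; rewrite aE !inE eqxx.
Qed.

End Pathwise.

(** * Cylinder events of the driving families *)

Lemma uniform_prob_ray (R : realType) (c : R) : 0 <= c <= 1 ->
  uniform_prob (@ltr01 R) `]-oo, c]%classic = c%:E.
Proof.
move=> /andP[c0 c1]; rewrite /uniform_prob integral_uniform_pdf.
have -> : (`]-oo, c] `&` `[0, 1])%classic = `[0, c]%classic :> set R.
  apply/seteqP; split=> x /=; rewrite !in_itv /= ?andbT.
    by case=> xc /andP[x0 _]; rewrite x0.
  by case/andP=> x0 xc; rewrite xc x0 (le_trans xc c1).
transitivity (\int[lebesgue_measure]_(x in `[0%R, c]%classic) (cst 1%E x : \bar R))%E.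
  apply: eq_integral => x; rewrite inE /= in_itv /= => /andP[x0 xc].
  by rewrite /uniform_pdf x0 (le_trans xc c1) subr0 invr1.
rewrite integral_cst //= mul1e lebesgue_measure_itv /= lte_fin.
case: ltP => [_|c0']; first by rewrite sube0.
by congr EFin; apply/eqP; rewrite eq_le c0.
Qed.

Section RealProbability.
Variables (R : realType) (d : measure_display) (Omega : measurableType d).
Variable P : probability Omega R.

Definition pr (A : set Omega) : R := fine (P A).

Lemma prE A : measurable A -> P A = (pr A)%:E.
Proof. by move=> mA; rewrite /pr fineK // fin_num_measure. Qed.

Lemma pr_ge0 A : 0 <= pr A.
Proof. by rewrite fine_ge0. Qed.

Lemma pr0 : pr set0 = 0.
Proof. by rewrite /pr measure0. Qed.

Lemma prT : pr setT = 1.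
Proof. by rewrite /pr probability_setT. Qed.

Lemma le_pr A B : measurable A -> measurable B -> A `<=` B -> pr A <= pr B.
Proof.
move=> mA mB AB; rewrite -lee_fin -!prE //; apply: le_measure => //; by rewrite inE.
Qed.

Lemma prDI A B : measurable A -> measurable B -> pr A = pr (A `\` B) + pr (A `&` B).
Proof.
move=> mA mB; apply: EFin_inj; rewrite EFinD -!prE //; first exact: measureDI.
  exact: measurableI.
exact: measurableD.
Qed.

Lemma measurable_none (T : eqType) (s : seq T) (F : T -> set Omega) :
  (forall i, measurable (F i)) -> measurable [set o | forall i, i \in s -> ~ F i o].
Proof.
move=> mF; elim: s => [|j r mr]; first by rewrite (_ : mkset _ = setT) //; apply/seteqP; split.
rewrite (_ : mkset _ = ~` F j `&` [set o | forall i, i \in r -> ~ F i o]).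
  by apply: measurableI => //; exact: measurableC.
apply/seteqP; split=> o /=.
  move=> H; split; first by apply: H; rewrite mem_head.
  by move=> k kr; apply: H; rewrite inE kr orbT.
by case=> Fj H k; rewrite inE => /orP[/eqP->|/H].
Qed.

Lemma pr_split (T : eqType) (s : seq T) (F : T -> set Omega) A : uniq s ->
    measurable A -> (forall i, measurable (F i)) ->
    (forall i j, i != j -> F i `&` F j = set0) ->
  pr A = \sum_(i <- s) pr (A `&` F i)
         + pr (A `&` [set o | forall i, i \in s -> ~ F i o]).
Proof.
move=> + mA mF disj; elim: s => [_|i s IHs /= /andP[is_ us]].
  rewrite big_nil add0r; congr pr; rewrite -[LHS]setIT; congr (_ `&` _).
  by apply/seteqP; split.
have mrest := measurable_none s mF.
suff E : pr (A `&` [set o | forall j, j \in s -> ~ F j o])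
    = pr (A `&` F i) + pr (A `&` [set o | forall j, j \in i :: s -> ~ F j o]).
  by rewrite IHs // big_cons E; ring.
rewrite [LHS](prDI (B := F i)) //; last exact: measurableI.
rewrite addrC; congr (pr _ + pr _); last first.
  apply/seteqP; split=> o /=.
    case=> -[Ao H] Fi; split=> // j; rewrite inE => /orP[/eqP->//|/H//].
  case=> Ao H; split; last by apply: H; rewrite mem_head.
  by split=> // j js; apply: H; rewrite inE js orbT.
rewrite setIAC; apply/seteqP; split=> o /=; first by case.
move=> [Ao Fi]; split=> // j js Fj.
have ij : i != j by apply: contraNneq is_ => ->.
by have : (F i `&` F j) o by []; rewrite disj.
Qed.

Lemma cvg_pr (F : nat -> set Omega) : (forall n, measurable (F n)) ->
    (forall n, F n `<=` F n.+1) ->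
  pr (F n) @[n --> \oo] --> pr (\bigcup_n F n).
Proof.
move=> mF FS; have mU : measurable (\bigcup_n F n) by exact: bigcupT_measurable.
have mono : {homo F : n m / (n <= m)%N >-> (n <= m)%O}.
  apply: homo_leq => [A|B A C|n]; [exact: lexx|exact: le_trans|].
  by rewrite subsetEset; exact: FS.
have /fine_cvgP[_] : P (F n) @[n --> \oo] --> (pr (\bigcup_n F n))%:E; last exact.
by rewrite -prE //; exact: nondecreasing_cvg_mu mF mU mono.
Qed.

Lemma pr_setI1 A B : measurable A -> measurable B -> pr B = 1 -> pr (A `&` B) = pr A.
Proof.
move=> mA mB B1; rewrite [RHS](prDI (B := B)) //.
suff -> : pr (A `\` B) = 0 by rewrite add0r.
apply/eqP; rewrite eq_le pr_ge0 andbT.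
have := prDI measurableT mB; rewrite prT setTI B1 -[X in X = _]add0r => /addIr ->.
by apply: le_pr; [exact: measurableD|exact: measurableD|move=> o []].
Qed.

End RealProbability.

Section Driving.
Variables (R : realType) (V : countType) (e : rel V).
Variables (d : measure_display) (Omega : measurableType d) (P : probability Omega R).
Variables (X : V -> nat -> Omega -> V) (Y : V -> nat -> Omega -> R).
Hypothesis HD : driving_families P e X Y.

Local Notation pr := (pr P).

Lemma measurable_walk v n u : measurable (X v n @^-1` [set u]).
Proof. by have [HX _ _] := HD; have [mX _] := HX v; exact: mX. Qed.

Lemma measurable_test v n (B : set R) : measurable B -> measurable (Y v n @^-1` B).
Proof.
by move=> mB; have [_ HY _] := HD; have [mY _ _] := HY v; rewrite -[_ @^-1` _]setTI; exact: mY.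
Qed.

Definition walk_cyl (v : V) (s : seq V) : set Omega :=
  [set o | X v 0%N o = v /\ [seq X v k o | k <- iota 1 (size s)] = s].

Definition test_cyl (v : V) (Bs : seq (set R)) : set Omega :=
  [set o | forall i, (i < size Bs)%N -> nth setT Bs i (Y v i.+1 o)].

Lemma walk_cyl_nil v : walk_cyl v [::] = X v 0%N @^-1` [set v].
Proof. by apply/seteqP; split=> o /=; [case|]. Qed.

Lemma walk_cyl_rcons v s u :
  walk_cyl v (rcons s u) = walk_cyl v s `&` X v (size s).+1 @^-1` [set u].
Proof.
have E o : [seq X v k o | k <- iota 1 (size (rcons s u))]
    = rcons [seq X v k o | k <- iota 1 (size s)] (X v (size s).+1 o).
  by have := iotaD 1 (size s) 1; rewrite size_rcons addn1 add1n cats1 -map_rcons => ->.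
rewrite /walk_cyl; apply/seteqP; split=> o /=.
  by case=> X0; rewrite E => /rcons_inj[-> ->].
by case=> -[X0 Xs] Xu; rewrite E Xs Xu.
Qed.

Lemma test_cyl_rcons v Bs B :
  test_cyl v (rcons Bs B) = test_cyl v Bs `&` Y v (size Bs).+1 @^-1` B.
Proof.
rewrite /test_cyl; apply/seteqP; split=> o /=.
  move=> H; split=> [i iB|].
    by have := H i; rewrite size_rcons nth_rcons iB; apply; rewrite ltnW.
  by have := H (size Bs); rewrite size_rcons nth_rcons ltnn eqxx; apply.
case=> H HB i; rewrite size_rcons ltnS leq_eqVlt nth_rcons => /orP[/eqP->|iB].
  by rewrite ltnn eqxx.
by rewrite iB; exact: H.
Qed.

Lemma walk_cyl_in (M : set (set Omega)) v s : setI_closed M ->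
  (forall n u, M (X v n @^-1` [set u])) -> M (walk_cyl v s).
Proof.
move=> MI MX; elim/last_ind: s => [|s u IHs]; first by rewrite walk_cyl_nil.
by rewrite walk_cyl_rcons; exact: MI.
Qed.

Definition measurable_sets (Bs : seq (set R)) : Prop :=
  forall i, measurable (nth setT Bs i).

Lemma measurable_sets_rcons Bs B :
  measurable_sets (rcons Bs B) <-> measurable_sets Bs /\ measurable B.
Proof.
split=> [H|[H mB] i].
  split=> [i|]; last by have := H (size Bs); rewrite nth_rcons ltnn eqxx.
  have := H i; rewrite nth_rcons; case: ltnP => // iB _; rewrite nth_default //.
by rewrite nth_rcons; case: ifP => // _; case: ifP.
Qed.

Lemma test_cyl_in (M : set (set Omega)) v Bs : M setT -> setI_closed M ->
  (forall n B, measurable B -> M (Y v n @^-1` B)) -> measurable_sets Bs ->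
  M (test_cyl v Bs).
Proof.
move=> MT MI MY; elim/last_ind: Bs => [|Bs B IHB].
  by move=> _; rewrite (_ : test_cyl v [::] = setT) //; apply/seteqP; split.
by move/measurable_sets_rcons=> [mBs mB]; rewrite test_cyl_rcons; apply: MI; [exact: IHB|exact: MY].
Qed.

Definition cyl (v : V) (h : seq (V * set R)) : set Omega :=
  walk_cyl v (unzip1 h) `&` test_cyl v (unzip2 h).

Definition uniform_mass (B : set R) : R := fine (uniform_prob (@ltr01 R) B).

Lemma uniform_massE B : measurable B ->
  uniform_prob (@ltr01 R) B = (uniform_mass B)%:E.
Proof. by move=> mB; rewrite fineK // fin_num_measure. Qed.

Definition cyl_prob (v : V) (h : seq (V * set R)) : R :=
  srw_prob R e v (unzip1 h) * \prod_(B <- unzip2 h) uniform_mass B.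

Lemma cyl_rcons v h u B : cyl v (rcons h (u, B))
  = cyl v h `&` (X v (size h).+1 @^-1` [set u] `&` Y v (size h).+1 @^-1` B).
Proof.
rewrite /cyl /unzip1 /unzip2 !map_rcons walk_cyl_rcons test_cyl_rcons !size_map.
by rewrite setIACA.
Qed.

Lemma cyl_prob_rcons v h u B : cyl_prob v (rcons h (u, B))
  = cyl_prob v h * (srw_step R e (last v (unzip1 h)) u * uniform_mass B).
Proof.
rewrite /cyl_prob /unzip1 /unzip2 !map_rcons -!cats1 srw_prob_cat /= mulr1.
by rewrite big_cat /= big_seq1; ring.
Qed.

Lemma measurable_cyl v h : measurable_sets (unzip2 h) -> measurable (cyl v h).
Proof.
move=> mh; apply: measurableI.
  apply: walk_cyl_in; [exact: measurableI|exact: measurable_walk].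
apply: test_cyl_in mh; [exact: measurableT|exact: measurableI|].
by move=> n B; exact: measurable_test.
Qed.

Lemma P_test_cyl v Bs : measurable_sets Bs ->
  P (test_cyl v Bs) = (\prod_(B <- Bs) uniform_mass B)%:E.
Proof.
move=> mBs; have [_ HY _] := HD; have [mY lawY indY] := HY v.
pose J := [fset n in iota 1 (size Bs)]%fset.
pose A n := Y v n @^-1` (nth setT Bs n.-1).
have pJ : perm_eq J (iota 1 (size Bs)).
  apply: uniq_perm; [exact: fset_uniq|exact: iota_uniq|].
  by move=> n; rewrite inE.
have -> : test_cyl v Bs = \bigcap_(n in [set` J]) A n.
  apply/seteqP; split=> o /= H => [n|i iB].
    by rewrite /= inE mem_iota => /andP[n0 nB]; have := H n.-1; rewrite /A /= prednK //; apply; lia.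
  by apply: (H i.+1); rewrite /= inE mem_iota /=; lia.
rewrite indY; last by move=> n _; exists (nth setT Bs n.-1) => //; exact: mBs.
rewrite (perm_big _ pJ) /= -[1%N]addn0 iotaDl big_map (big_nth setT) -/(index_iota 0 (size Bs)).
rewrite -prodEFin /index_iota subn0; apply: eq_bigr => i _.
by rewrite /A /= lawY ?uniform_massE //; exact: mBs.
Qed.

Definition cyls (hs : V -> seq (V * set R)) (vs : seq V) : set Omega :=
  [set o | forall v, v \in vs -> cyl v (hs v) o].

Lemma cyls_cons hs v vs : cyls hs (v :: vs) = cyl v (hs v) `&` cyls hs vs.
Proof.
apply/seteqP; split=> o /=.
  by move=> H; split=> [|w wvs]; apply: H; rewrite ?mem_head // inE wvs orbT.
by case=> Hv H w; rewrite inE => /orP[/eqP->//|/H].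
Qed.

Lemma cyls_nil hs : cyls hs [::] = setT.
Proof. by apply/seteqP; split. Qed.

Lemma measurable_cyls hs vs : (forall v, measurable_sets (unzip2 (hs v))) ->
  measurable (cyls hs vs).
Proof.
move=> mhs; elim: vs => [|v vs IHvs]; first by rewrite cyls_nil.
by rewrite cyls_cons; apply: measurableI => //; exact: measurable_cyl.
Qed.

(** The [inl] and [inr] coordinates of mutual independence give a product over
    walks and over tests. *)
Lemma P_cyls (hs : V -> seq (V * set R)) vs : uniq vs ->
    (forall v, measurable_sets (unzip2 (hs v))) ->
  P (cyls hs vs) = (\prod_(v <- vs) cyl_prob v (hs v))%:E.
Proof.
move=> uvs mhs; have [HX HY ind] := HD.
pose l : seq (V + V) := [seq inl v | v <- vs] ++ [seq inr v | v <- vs].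
pose J := [fset i in l]%fset.
pose A (i : V + V) := match i with
  | inl v => walk_cyl v (unzip1 (hs v)) | inr v => test_cyl v (unzip2 (hs v)) end.
have ul : uniq l.
  have il : injective (@inl V V) by move=> ? ? [].
  have ir : injective (@inr V V) by move=> ? ? [].
  rewrite cat_uniq (map_inj_uniq il) (map_inj_uniq ir) uvs andbT /=.
  by apply/hasPn => _ /mapP[v _ ->]; apply/mapP => -[].
have pJ : perm_eq J l.
  by apply: uniq_perm; [exact: fset_uniq|exact: ul|move=> i; rewrite in_fset].
have -> : cyls hs vs = \bigcap_(i in [set` J]) A i.
  apply/seteqP; split=> o /= H.
    move=> i; rewrite /= (perm_mem pJ) mem_cat.
    by case/orP=> /mapP[v vvs ->] /=; have [] := H v vvs.
  move=> v vvs; split.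
    by apply: (H (inl v)); rewrite /= (perm_mem pJ) mem_cat map_f.
  by apply: (H (inr v)); rewrite /= (perm_mem pJ) mem_cat map_f ?orbT.
rewrite ind => [|[v|v] _] /=.
- rewrite (perm_big _ pJ) /= big_cat !big_map /= -prodEFin -big_split /=.
  apply: eq_bigr => v _; have [_ ->] := HX v.
  by rewrite P_test_cyl.
- apply: walk_cyl_in; last by move=> n u; apply: sub_sigma_algebra; exists n, u.
  by move=> B C; exact: (@measurableI _ (g_sigma_algebraType _)).
- apply: test_cyl_in => //.
  + exact: (@measurableT _ (g_sigma_algebraType _)).
  + by move=> B C; exact: (@measurableI _ (g_sigma_algebraType _)).
  + by move=> n B mB; apply: sub_sigma_algebra; exists n; exists B.
Qed.

End Driving.

(** * The law of the algorithm in a finite domain *)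

Section Law.
Variables (R : realType) (V : countType) (e : rel V) (p : seq V -> R) (x0 : V).
Hypothesis Hfin : locally_finite e.
Hypothesis Hp : weight_function e p.
Hypothesis Hdeg : forall v, exists u, e v u.
Hypothesis Hexit : forall (U : {fset V}) x, x \in U ->
  exists ys y, [/\ path e x (rcons ys y), uniq (x :: ys), all [in U] ys & y \notin U].
Hypothesis Hirr : irreflexive e.
Variables (d : measure_display) (Omega : measurableType d) (P : probability Omega R).
Variables (X : V -> nat -> Omega -> V) (Y : V -> nat -> Omega -> R).
Hypothesis HD : driving_families P e X Y.

Local Notation pr := (pr P).
Local Notation lw := (loop_weight e p).
Local Notation cyl := (cyl X Y).

Lemma measurable_discrete (T : countType) (f : Omega -> T) (M : T -> set Omega) :
    (forall t, measurable (f @^-1` [set t])) -> (forall t, measurable (M t)) ->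
  measurable [set o | M (f o) o].
Proof.
move=> mf mM; have -> : [set o | M (f o) o] = \bigcup_t (f @^-1` [set t] `&` M t).
  by apply/seteqP; split=> o /=; [move=> Mo; exists (f o)|case=> t _ [/= ->]].
apply: countable_bigcupT_measurable => [|t]; first exact: countableP.
exact: measurableI.
Qed.

Lemma measurable_walk_dep v n (M : V -> set Omega) : (forall u, measurable (M u)) ->
  measurable [set o | M (X v n o) o].
Proof. by apply: measurable_discrete => u; exact: (measurable_walk HD). Qed.

Lemma measurable_test_dep v n c (A B : set Omega) : measurable A -> measurable B ->
  measurable [set o | if Y v n o <= c then A o else B o].
Proof.
move=> mA mB; pose C := Y v n @^-1` `]-oo, c]%classic.
have mC : measurable C by apply: (measurable_test HD); exact: measurable_itv.
have -> : [set o | if Y v n o <= c then A o else B o] = (C `&` A) `|` (~` C `&` B).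
  apply/seteqP; split=> o /=; rewrite /C /= in_itv /=.
    by case: ifPn => Yc Qo; [left|right; split=> //; apply/negP].
  by case: ifPn => Yc [] [].
by apply: measurableU; apply: measurableI => //; exact: measurableC.
Qed.

Definition ended_event (U : {pred V}) v n m s (Q : seq V -> set Omega) : set Omega :=
  [set o | if ends_within e p U (X v ^~ o) (Y v ^~ o) n m s is Some t then Q t o
           else False].

Lemma measurable_ended U v n m s Q : (forall t, measurable (Q t)) ->
  measurable (ended_event U v n m s Q).
Proof.
move=> mQ; elim: n m s => [|n IHn] m s.
  by rewrite (_ : ended_event _ _ _ _ _ _ = set0) //; apply/seteqP; split.
pose M u : set Omega := [set o | if u \in U then
    if u \in s then
      if Y v m.+1 o <= lw (loop_at s u) then Q (rcons s u) o
      else ended_event U v n m.+1 (erased_at s u) Q o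
    else ended_event U v n m.+1 (rcons s u) Q o
  else Q (rcons s u) o].
rewrite (_ : ended_event _ _ _ _ _ _ = [set o | M (X v m.+1 o) o]).
  apply: measurable_walk_dep => u; rewrite /M; case: (u \in U); last exact: mQ.
  by case: (u \in s); [exact: measurable_test_dep|exact: IHn].
apply/funext => o; rewrite /ended_event /M /=.
by case: (_ \in U) => //; case: (_ \in s) => //; case: (Y v m.+1 o <= _).
Qed.

Lemma uniform_massT : uniform_mass (setT : set R) = 1.
Proof. by rewrite /uniform_mass probability_setT. Qed.

Lemma uniform_mass_ray c : 0 <= c <= 1 -> uniform_mass (`]-oo, c]%classic : set R) = c.
Proof. by move=> c01; rewrite /uniform_mass uniform_prob_ray. Qed.

Lemma uniform_mass_rayC c : 0 <= c <= 1 ->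
  uniform_mass (~` `]-oo, c]%classic : set R) = 1 - c.
Proof.
move=> c01; rewrite /uniform_mass probability_setC; last exact: measurable_itv.
by rewrite [X in (1 - X)%E](uniform_prob_ray c01).
Qed.

(** A single walk is run after the event [D] of its past, and [Q t] is an event of
    the other walks, of probability [f t], which depends on the final path [t].
    Both are known only through their independence of the cylinders of the walk. *)
Section OneWalk.
Variables (D : set Omega) (v : V) (U : {pred V}) (Q : seq V -> set Omega) (f : seq V -> R).
Hypothesis mD : measurable D.
Hypothesis mQ : forall t, measurable (Q t).
Hypothesis indD : forall h, measurable_sets (unzip2 h) ->
  pr (D `&` cyl v h) = pr D * cyl_prob e v h.
Hypothesis indQ : forall h t, measurable_sets (unzip2 h) -> ohead t = Some v ->
  pr (D `&` cyl v h `&` Q t) = pr (D `&` cyl v h) * f t.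

Let mDcyl (h : seq (V * set R)) : measurable_sets (unzip2 h) -> measurable (D `&` cyl v h).
Proof. by move=> mh; apply: measurableI => //; exact: (measurable_cyl HD). Qed.

Let msets_rcons (h : seq (V * set R)) u B : measurable_sets (unzip2 h) ->
  measurable B -> measurable_sets (unzip2 (rcons h (u, B))).
Proof.
move=> mh mB; rewrite /unzip2 map_rcons.
exact: (proj2 (measurable_sets_rcons _ _) (conj mh mB)).
Qed.

Let pr_rcons (h : seq (V * set R)) u B : measurable_sets (unzip2 h) -> measurable B ->
  pr (D `&` cyl v (rcons h (u, B)))
  = pr (D `&` cyl v h) * (srw_step R e (last v (unzip1 h)) u * uniform_mass B).
Proof.
move=> mh mB; rewrite indD; last exact: msets_rcons.
by rewrite cyl_prob_rcons mulrA indD.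
Qed.

(** The neighbours carry all the mass, so no other next vertex has any. *)
Let pr_nbrs (h : seq (V * set R)) A : measurable_sets (unzip2 h) -> measurable A -> A `<=` D `&` cyl v h ->
  pr A = \sum_(u <- nbrs e (last v (unzip1 h))) pr (A `&` X v (size h).+1 @^-1` [set u]).
Proof.
move=> mh mA AD; pose F u := X v (size h).+1 @^-1` [set u].
have mF u : measurable (F u) by exact: (measurable_walk HD).
have dF u w : u != w -> F u `&` F w = set0.
  move=> /eqP uw; apply/seteqP; split=> o //=; rewrite /F /= => -[Xu Xw].
  by apply: uw; rewrite -Xu -Xw.
have un : uniq (nbrs e (last v (unzip1 h))) by exact: fset_uniq.
rewrite (pr_split _ un mA mF dF) -[RHS]addr0; congr (_ + _).
have mrest := measurable_none (nbrs e (last v (unzip1 h))) mF.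
apply/eqP; rewrite eq_le pr_ge0 andbT.
have := pr_split P un (mDcyl mh) mF dF.
rewrite (_ : \sum_(u <- _) _ = pr (D `&` cyl v h)) => [H|].
  rewrite (_ : 0 = pr (D `&` cyl v h `&`
      [set o | forall u, u \in nbrs e (last v (unzip1 h)) -> ~ F u o])).
    apply: le_pr; [exact: measurableI|by apply: measurableI => //; exact: mDcyl|].
    by move=> o [/AD].
  by apply: (addrI (pr (D `&` cyl v h))); rewrite addr0 -H.
rewrite -[RHS]mulr1 -[in RHS](next_mean_const (R := R) Hfin Hdeg (last v (unzip1 h)) 1).
rewrite /next_mean mulr_sumr; apply: eq_bigr => u _.
have -> : D `&` cyl v h `&` F u = D `&` cyl v (rcons h (u, setT)).
  by rewrite cyl_rcons preimage_setT setIT setIA.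
by rewrite pr_rcons ?uniform_massT //; exact: measurableT.
Qed.

Lemma pr_ended n (h : seq (V * set R)) s : measurable_sets (unzip2 h) ->
    ohead s = Some v -> last x0 s = last v (unzip1 h) ->
  pr (D `&` cyl v h `&` ended_event U v n (size h) s Q)
  = pr (D `&` cyl v h) * payoff_within e p x0 U f n s.
Proof.
elim: n h s => [|n IHn] h s mh hs ls.
  have E0 : ended_event U v 0 (size h) s Q = set0 by apply/seteqP; split.
  by rewrite E0 setI0 pr0 mulr0.
have mE : measurable (D `&` cyl v h `&` ended_event U v n.+1 (size h) s Q).
  by apply: measurableI; [exact: mDcyl|exact: measurable_ended].
rewrite (pr_nbrs mh mE); last by move=> o [].
rewrite /= /lerw_mean /next_mean ls mulr_sumr; apply: eq_bigr => u _.
have IH u' s' B : measurable B -> ohead s' = Some v -> last x0 s' = u' ->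
    pr (D `&` cyl v (rcons h (u', B)) `&` ended_event U v n (size h).+1 s' Q)
    = pr (D `&` cyl v h) * (srw_step R e (last v (unzip1 h)) u' * uniform_mass B)
      * payoff_within e p x0 U f n s'.
  move=> mB hs' ls'; rewrite -(size_rcons h (u', B)) IHn ?pr_rcons //; first exact: msets_rcons.
  by rewrite /unzip1 map_rcons last_rcons.
have hr u' : ohead (rcons s u') = Some v by case: (s) hs.
have IQ u' t B : measurable B -> ohead t = Some v ->
    pr (D `&` cyl v (rcons h (u', B)) `&` Q t)
    = pr (D `&` cyl v h) * (srw_step R e (last v (unzip1 h)) u' * uniform_mass B) * f t.
  by move=> mB ht; rewrite indQ ?pr_rcons //; exact: msets_rcons.
have mT : measurable (setT : set R) by exact: measurableT.
case: ifPn => uU; last first.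
  transitivity (pr (D `&` cyl v (rcons h (u, setT)) `&` Q (rcons s u))).
    congr pr; rewrite cyl_rcons; apply/seteqP; split=> o /=.
      case=> -[[Do ho] + Xu]; rewrite /ended_event /= Xu (negbTE uU) => Qo.
      exact: (conj (conj Do (conj ho (conj erefl I))) Qo).
    case=> -[Do [ho [Xu _]]] Qo; split=> //; split=> //.
    by rewrite /ended_event /= Xu (negbTE uU).
  by rewrite IQ // uniform_massT; ring.
case: ifPn => us; last first.
  transitivity (pr (D `&` cyl v (rcons h (u, setT))
                    `&` ended_event U v n (size h).+1 (rcons s u) Q)).
    congr pr; rewrite cyl_rcons; apply/seteqP; split=> o /=.
      case=> -[[Do ho] + Xu]; rewrite /ended_event /= Xu uU (negbTE us) => Qo.
      exact: (conj (conj Do (conj ho (conj erefl I))) Qo).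
    case=> -[Do [ho [Xu _]]] Qo; split=> //; split=> //.
    by rewrite /ended_event /= Xu uU (negbTE us).
  by rewrite IH ?last_rcons // uniform_massT; ring.
have c01 := loop_weight01 Hp (loop_at s u).
set c := lw (loop_at s u) in c01 *.
have mC : measurable (`]-oo, c]%classic : set R) by exact: measurable_itv.
rewrite (prDI P (B := Y v (size h).+1 @^-1` `]-oo, c]%classic)); last 2 first.
- by apply: measurableI => //; exact: (measurable_walk HD).
- exact: (measurable_test HD).
rewrite addrC mulrDr mulrDr; congr (_ + _).
  transitivity (pr (D `&` cyl v (rcons h (u, `]-oo, c]%classic)) `&` Q (rcons s u))).
    congr pr; rewrite cyl_rcons; apply/seteqP; split=> o /=; rewrite in_itv /=.
      case=> -[[[Do ho] + Xu] Yc]; rewrite /ended_event /= Xu uU us Yc => Qo.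
      exact: (conj (conj Do (conj ho (conj erefl isT))) Qo).
    case=> -[Do [ho [Xu Yc]]] Qo; refine (conj (conj (conj (conj Do ho) _) Xu) Yc).
    by rewrite /ended_event /= Xu uU us Yc.
  by rewrite IQ // uniform_mass_ray //; ring.
transitivity (pr (D `&` cyl v (rcons h (u, ~` `]-oo, c]%classic))
                  `&` ended_event U v n (size h).+1 (erased_at s u) Q)).
  congr pr; rewrite cyl_rcons; apply/seteqP; split=> o /=; rewrite in_itv /=.
    case=> -[[[Do ho] + Xu] nYc]; have /negP/negbTE Yc := nYc.
    rewrite /ended_event /= Xu uU us Yc => Qo.
    exact: (conj (conj Do (conj ho (conj erefl not_false_is_true))) Qo).
  case=> -[Do [ho [Xu nYc]]] Qo; have /negP/negbTE Yc := nYc.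
  refine (conj (conj (conj (conj Do ho) _) Xu) nYc).
  by rewrite /ended_event /= Xu uU us Yc.
have he : ohead (erased_at s u) = Some v by case: (s) hs.
by rewrite IH ?last_erased_at ?uniform_mass_rayC //; [ring|exact: measurableC].
Qed.

Hypothesis Uv : v \in U.
Hypothesis f01 : unit_valued f.

Lemma pr_ended_eventually :
  pr (D `&` cyl v [::] `&` \bigcup_n ended_event U v n 0 [:: v] Q)
  = pr D * payoff e p x0 U f [:: v].
Proof.
have mh : measurable_sets (unzip2 ([::] : seq (V * set R))).
  by move=> i; rewrite nth_nil; exact: measurableT.
have DE : pr (D `&` cyl v [::]) = pr D.
  by rewrite indD // /cyl_prob /= big_nil !mulr1.
pose F n := D `&` cyl v [::] `&` ended_event U v n 0 [:: v] Q.
have mF n : measurable (F n).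
  by apply: measurableI; [exact: mDcyl|exact: measurable_ended].
have FS n : F n `<=` F n.+1.
  move=> o [Do]; rewrite /F /ended_event /=.
  case hE : (ends_within _ _ _ _ _ n _ _) => [t|] // Qt; split=> //.
  by rewrite /= -/(ends_within e p U _ _ n.+1 0 [:: v]) (ends_withinS hE).
have lim : pr (F n) @[n --> \oo] --> pr D * payoff e p x0 U f [:: v].
  under eq_cvg => n do rewrite /F (@pr_ended n [::] [:: v] mh) // DE.
  by apply: cvgMr; apply: cvg_payoff_within => //; exact: path_in1.
rewrite setI_bigcupr -(cvg_lim _ (cvg_pr (P := P) mF FS)) //.
exact: cvg_lim lim.
Qed.

End OneWalk.

(** With an event [M S] for each value [S] of the state, rather than a set of
    states, what is asked of the state may itself vary with the sample point. *)
Lemma measurable_lerw_dep v n (M : lerw_state V -> set Omega) :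
    (forall S, measurable (M S)) ->
  measurable [set o | M (lerw e p (X v ^~ o) (Y v ^~ o) n) o].
Proof.
elim: n M => [|n IHn] M mM.
  exact: (@measurable_walk_dep v 0%N (fun u => M (Walking [:: u]))).
pose M' S := [set o | M (lerw_step e p S (X v n.+1 o) (Y v n.+1 o)) o].
apply: (IHn M') => -[s|s]; rewrite /M' /=; last exact: mM.
apply: (@measurable_walk_dep v n.+1 (fun u => [set o |
  M (if u \notin s then Walking (rcons s u)
     else if Y v n.+1 o <= lw (drop (index u s) s) then Rooted (rcons s u)
     else Walking (take (index u s).+1 s)) o])) => u.
case: (u \notin s); first exact: mM.
rewrite (_ : mkset _ = [set o | if Y v n.+1 o <= lw (drop (index u s) s)
   then M (Rooted (rcons s u)) o else M (Walking (take (index u s).+1 s)) o]).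
  exact: measurable_test_dep.
by apply/funext => o /=; case: (Y v n.+1 o <= _).
Qed.

Lemma measurable_has_ended v W n :
  measurable [set o | has_ended e p W (X v ^~ o) (Y v ^~ o) n].
Proof.
apply: (@measurable_lerw_dep v n (fun S => [set o | is_rooted S \/ W (X v n o)])) => S.
case: (is_rooted S); first by rewrite (_ : mkset _ = setT) //; apply/seteqP; split=> o //= _; left.
apply: (@measurable_walk_dep v n (fun u => [set _ | false \/ W u])) => u.
have [Wu|Wu] := pselect (W u).
  by rewrite (_ : mkset _ = setT) //; apply/seteqP; split=> o //= _; right.
by rewrite (_ : mkset _ = set0) //; apply/seteqP; split=> o //= -[].
Qed.

Lemma measurable_ending_time v W t :
  measurable [set o | ending_time e p W (X v ^~ o) (Y v ^~ o) = t].
Proof.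
have mS T : measurable [set o | ending_time e p W (X v ^~ o) (Y v ^~ o) = Some T].
  pose F i := [set o | has_ended e p W (X v ^~ o) (Y v ^~ o) i].
  have mF i : measurable (F i) by exact: measurable_has_ended.
  rewrite (_ : mkset _ = F T `&` [set o | forall i, i \in iota 0 T -> ~ F i o]).
    by apply: measurableI => //; exact: measurable_none.
  apply/seteqP; split=> o /=.
    by move/ending_timeP=> [eT nT]; split=> // i; rewrite mem_iota; exact: nT.
  case=> eT nT; apply/ending_timeP; split=> // i iT.
  by apply: nT; rewrite mem_iota.
case: t => // ; rewrite (_ : mkset _ =
  ~` (\bigcup_T [set o | ending_time e p W (X v ^~ o) (Y v ^~ o) = Some T])).
  by apply: measurableC; exact: bigcupT_measurable.
apply/seteqP; split=> o /=; first by move=> hN [T _ /=]; rewrite hN.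
by case hE : (ending_time _ _ _ _ _) => [T|] // H; case: H; exists T.
Qed.

Lemma measurable_lerw_final_dep v W (M : seq V -> set Omega) : (forall t, measurable (M t)) ->
  measurable [set o | M (lerw_final e p W (X v ^~ o) (Y v ^~ o)) o].
Proof.
move=> mM; pose M' (T : option nat) := [set o |
  M (if T is Some n then lerw_trace (lerw e p (X v ^~ o) (Y v ^~ o) n) else [::]) o].
apply: (@measurable_discrete _ (fun o => ending_time e p W (X v ^~ o) (Y v ^~ o)) M').
  exact: measurable_ending_time.
move=> [n|]; last exact: mM.
exact: (@measurable_lerw_dep v n (fun S => M (lerw_trace S))).
Qed.

Definition wired_event (vs : seq V) (U : {fset V}) (g : V -> V) (phi : (V -> V) -> bool) :
    set Omega :=
  [set o | if wired_state e p (fun x n => X x n o) (fun x n => Y x n o) vs U g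
             is Some Ug then phi Ug.2 else False].

Lemma measurable_wired vs U g phi : measurable (wired_event vs U g phi).
Proof.
elim: vs U g => [|v vs IHvs] U g.
  case hphi : (phi g).
    rewrite (_ : wired_event _ _ _ _ = setT) //; apply/seteqP; split=> o //=;
      by rewrite /wired_event /= hphi.
  rewrite (_ : wired_event _ _ _ _ = set0) //; apply/seteqP; split=> o //=;
    by rewrite /wired_event /= hphi.
rewrite /wired_event /=; case: (v \in U); last exact: IHvs.
pose M (t : seq V) : set Omega :=
  if t == [::] then set0 else wired_event vs (fset_minus U t) (follow g t) phi.
rewrite (_ : mkset _ = [set o | M (lerw_final e p [set z | z \notin U] (X v ^~ o) (Y v ^~ o)) o]).
  by apply: measurable_lerw_final_dep => t; rewrite /M; case: ifP.
by apply/funext => o; rewrite /M /=; case: (_ == [::]).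
Qed.

(** Independence of all the walks not yet used, stated on cylinders, which is
    enough for [pr_ended]. *)
Definition independent_of (D : set Omega) (vs : seq V) : Prop :=
  forall hs : V -> seq (V * set R), (forall v, measurable_sets (unzip2 (hs v))) ->
    pr (D `&` cyls X Y hs vs) = pr D * \prod_(v <- vs) cyl_prob e v (hs v).

Let mnil : measurable_sets (unzip2 ([::] : seq (V * set R))).
Proof. by move=> i; rewrite nth_nil; exact: measurableT. Qed.

Let cyl_prob_nil v : cyl_prob (R := R) e v [::] = 1.
Proof. by rewrite /cyl_prob /= big_nil mulr1. Qed.

Lemma pr_cyls hs vs : uniq vs -> (forall v, measurable_sets (unzip2 (hs v))) ->
  pr (cyls X Y hs vs) = \prod_(v <- vs) cyl_prob e v (hs v).
Proof. by move=> uvs mhs; rewrite /pr (P_cyls HD). Qed.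

Lemma pr_start v : pr (cyl v [::]) = 1.
Proof.
have := @pr_cyls (fun=> [::]) [:: v] isT (fun=> mnil).
by rewrite cyls_cons cyls_nil setIT big_seq1 cyl_prob_nil.
Qed.

Lemma independent_cyl D v vs h : measurable D -> uniq (v :: vs) ->
    independent_of D (v :: vs) -> measurable_sets (unzip2 h) ->
  pr (D `&` cyl v h) = pr D * cyl_prob e v h /\ independent_of (D `&` cyl v h) vs.
Proof.
move=> mD /= /andP[vvs uvs] indD mh.
have key hs : (forall v, measurable_sets (unzip2 (hs v))) ->
    pr (D `&` cyl v h `&` cyls X Y hs vs)
    = pr D * cyl_prob e v h * \prod_(v <- vs) cyl_prob e v (hs v).
  move=> mhs; pose hs' w := if w == v then h else hs w.
  have mhs' w : measurable_sets (unzip2 (hs' w)) by rewrite /hs'; case: ifP.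
  have hsE w : w \in vs -> hs' w = hs w.
    by rewrite /hs'; case: eqP => // ->; rewrite (negbTE vvs).
  have := indD hs' mhs'; rewrite cyls_cons big_cons {1 3}/hs' eqxx.
  have -> : cyls X Y hs' vs = cyls X Y hs vs.
    by apply/seteqP; split=> o /= H w wvs; have := H w wvs; rewrite hsE.
  rewrite setIA => ->; rewrite mulrA; congr (_ * _).
  by apply: eq_big_seq => w wvs; rewrite hsE.
have DE : pr (D `&` cyl v h) = pr D * cyl_prob e v h.
  have := key (fun=> [::]) (fun=> mnil).
  rewrite pr_setI1; last 3 first.
  - by apply: measurableI => //; exact: (measurable_cyl HD).
  - exact: (measurable_cyls HD).
  - by rewrite pr_cyls // big1.
  by rewrite [\prod_(_ <- _) _]big1 ?mulr1.
by split=> // hs mhs; rewrite key // DE.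
Qed.

(** By [payoff_weighted_sum], running one more walk preserves on average the ratio
    of the remaining weighted sum to the remaining partition function; once the
    domain is empty, this ratio is the indicator of [phi]. *)
Lemma pr_wired vs (U : {fset V}) g (phi : (V -> V) -> bool) D : uniq vs ->
    {subset U <= vs} -> measurable D -> independent_of D vs ->
  pr (D `&` wired_event vs U g phi)
  = pr D * (weighted_sum e p U (fun h => (phi h)%:R) g / partition_function e p U).
Proof.
elim: vs U g D => [|v vs IHvs] U g D.
  move=> _ sub mD _; have -> : U = fset0.
    by apply/fsetP => z; rewrite inE; apply/negP => /sub.
  rewrite /partition_function /weighted_sum /map_weight /= !big_nil !mul1r divr1.
  case hphi : (phi g); rewrite ?mulr1 ?mulr0; [congr pr|rewrite -(pr0 P); congr pr].
    by apply/seteqP; split=> o /=; [case|]; rewrite /wired_event /= hphi.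
  by apply/seteqP; split=> o /=; [case|]; rewrite /wired_event /= hphi.
move=> uvs sub mD indD; have [vvs uvs'] := andP uvs.
have [vU|vU] := boolP (v \in U); last first.
  have [D1 ind1] := independent_cyl mD uvs indD mnil.
  have mDc : measurable (D `&` cyl v [::]).
    by apply: measurableI => //; exact: (measurable_cyl HD).
  have subU : {subset U <= vs}.
    by move=> z zU; have := sub z zU; rewrite inE => /orP[/eqP zv|//]; rewrite -zv zU in vU.
  have := IHvs U g _ uvs' subU mDc ind1; rewrite D1 cyl_prob_nil mulr1 => <-.
  rewrite -[LHS](@pr_setI1 _ _ _ P _ (cyl v [::])); last 3 first.
  - by apply: measurableI => //; exact: measurable_wired.
  - exact: (measurable_cyl HD).
  - exact: pr_start.
  congr pr; rewrite setIAC; congr (_ `&` _ `&` _).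
  by apply/funext => o; rewrite /wired_event /= (negbTE vU).
pose Q t := wired_event vs (fset_minus U t) (follow g t) phi.
pose f t := weighted_sum e p (fset_minus U t) (fun h => (phi h)%:R) (follow g t)
            / partition_function e p (fset_minus U t).
have phi01 h : 0 <= ((phi h)%:R : R) <= 1 by case: (phi h); rewrite ?lexx ?ler01.
have f01 : unit_valued f by move=> t; exact: weighted_ratio_unit.
rewrite -(payoff_weighted_sum x0 Hfin Hp Hdeg Hexit Hirr g vU phi01) -/f.
rewrite -(@pr_ended_eventually D v [in U] Q f) //; last 3 first.
- by move=> t; exact: measurable_wired.
- by move=> h mh; case: (independent_cyl mD uvs indD mh).
- move=> h t mh ht; have [_ indh] := independent_cyl mD uvs indD mh.
  have mDh : measurable (D `&` cyl v h).
    by apply: measurableI => //; exact: (measurable_cyl HD).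
  apply: IHvs => // z; rewrite in_fset_minus => /andP[/sub].
  rewrite inE => /orP[/eqP->|//].
  by case: t ht => //= w t [->]; rewrite mem_head.
have mW : measurable (wired_event (v :: vs) U g phi) by exact: measurable_wired.
rewrite -[LHS](@pr_setI1 _ _ _ P _ (cyl v [::])); last 3 first.
- exact: measurableI.
- exact: (measurable_cyl HD).
- exact: pr_start.
congr pr; rewrite setIAC; apply/seteqP; split=> o [Do];
  have X0 : X v 0%N o = v by case: Do => _ [[]].
  rewrite /wired_event /= vU; case: eqP => // /eqP t0 hphi; split=> //.
  have := @lerw_final_ends_within _ _ e p [in U] (X v ^~ o) (Y v ^~ o) _ _ t0.
  rewrite X0 => /(_ vU)[/(_ erefl)[n hn] _]; exists n => //.
  by rewrite /ended_event /= hn.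
move=> [n _]; rewrite /ended_event /=.
case hn : (ends_within _ _ _ _ _ _ _ _) => [t|] // Qt; split=> //.
rewrite /wired_event /= vU.
have t0 := ends_within_neq0 hn.
have := @lerw_final_ends_within _ _ e p [in U] (X v ^~ o) (Y v ^~ o) t _ t0.
by rewrite X0 => /(_ vU)[_ /(_ (ex_intro _ n hn)) ->]; rewrite (negbTE t0).
Qed.


(** * Passing to the infinite graph *)

Variable G : nat -> {fset V}.
Hypothesis HG : exhaustion e G.
Hypothesis Hloop : loop_assumption e G p.

Definition rooted_event v : set Omega :=
  [set o | exists T, is_rooted (lerw e p (X v ^~ o) (Y v ^~ o) T)].

Lemma measurable_is_rooted v T :
  measurable [set o | is_rooted (lerw e p (X v ^~ o) (Y v ^~ o) T)].
Proof.
apply: (@measurable_lerw_dep v T (fun S => [set _ | is_rooted S])) => S.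
case: (is_rooted S).
  by rewrite (_ : mkset _ = setT) //; apply/seteqP; split.
by rewrite (_ : mkset _ = set0) //; apply/seteqP; split.
Qed.

Lemma measurable_rooted_event v : measurable (rooted_event v).
Proof.
rewrite (_ : rooted_event v = \bigcup_T
  [set o | is_rooted (lerw e p (X v ^~ o) (Y v ^~ o) T)]).
  by apply: bigcupT_measurable => T; exact: measurable_is_rooted.
by apply/seteqP; split=> o /= [T]; [exists T|move=> _; exists T].
Qed.

Lemma pr_le1 A : measurable A -> pr A <= 1.
Proof. by move=> mA; rewrite -(prT P); apply: le_pr. Qed.

Lemma pr_rooted_event v : pr (rooted_event v) = 1.
Proof.
apply/eqP; rewrite eq_le (pr_le1 (measurable_rooted_event v)) /=.
have trT := transient_loop_assumption x0 Hfin Hp Hdeg Hexit HG Hloop.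
have one01 : unit_valued (fun _ : seq V => 1 : R) by move=> t; rewrite ler01 lexx.
have vT : path_in predT [:: v] by exact: path_in1.
have indT h : measurable_sets (unzip2 h) -> pr (setT `&` cyl v h) = pr setT * cyl_prob e v h.
  move=> mh; rewrite setTI prT mul1r.
  have := @pr_cyls (fun=> h) [:: v] isT (fun=> mh).
  by rewrite cyls_cons cyls_nil setIT big_seq1.
have := @pr_ended_eventually setT v predT (fun=> setT) (fun=> 1)
   measurableT (fun=> measurableT) indT _ isT one01.
rewrite (payoff1 Hfin Hdeg trT vT) prT mulr1 => <-; last by move=> h t _ _; rewrite setIT mulr1.
apply: le_pr; last first.
- move=> o [[_ [[X0 _] _]] [n _]]; rewrite /ended_event /=.
  case hn : (ends_within _ _ _ _ _ _ _ _) => [t|] // _.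
  have h0 : lerw e p (X v ^~ o) (Y v ^~ o) 0 = Walking [:: v] by rewrite /= X0.
  have [T /ending_timeP[[rT|//] _] _] := ends_within_final h0 (fun i _ => erefl) hn.
  by exists T.
- exact: measurable_rooted_event.
- apply: measurableI; first by apply: measurableI => //; exact: (measurable_cyl HD).
  by apply: bigcupT_measurable => n; exact: measurable_ended.
Qed.

Definition roots_event (S : {fset V}) (v : V) : set Omega :=
  [set o | roots_inside e p (fun x n => X x n o) (fun x n => Y x n o) S v].

Definition inside_event (vs : seq V) (S : {fset V}) : set Omega :=
  [set o | forall v, v \in vs -> roots_event S v o].

Lemma measurable_forall_mem (T : eqType) (s : seq T) (F : T -> set Omega) :
  (forall i, measurable (F i)) -> measurable [set o | forall i, i \in s -> F i o].
Proof.
move=> mF; rewrite (_ : mkset _ = [set o | forall i, i \in s -> ~ (~` F i) o]).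
  by apply: measurable_none => i; exact: measurableC.
by apply/seteqP; split=> o /= H i /H; [move=> ? | move/contrapT].
Qed.

Lemma measurable_inside vs S : measurable (inside_event vs S).
Proof.
apply: measurable_forall_mem => v.
pose Fn T := [set o | is_rooted (lerw e p (X v ^~ o) (Y v ^~ o) T)]
   `&` [set o | forall i, i \in iota 0 T.+1 -> [set o | X v i o \in S] o].
have -> : roots_event S v = X v 0%N @^-1` [set v] `&` \bigcup_T Fn T.
  apply/seteqP; split=> o /=.
    case=> X0 [T [rT XS]]; split=> //; exists T => //; split=> // i.
    by rewrite mem_iota add0n ltnS => /andP[_ iT]; exact: XS.
  case=> X0 [T _ [rT XS]]; split=> //; exists T; split=> // i iT.
  by apply: XS; rewrite mem_iota add0n ltnS iT.
apply: measurableI; first exact: (measurable_walk HD).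
apply: bigcupT_measurable => T; apply: measurableI; first exact: measurable_is_rooted.
apply: measurable_forall_mem => i.
apply: (@measurable_walk_dep v i (fun u => [set _ | u \in S])) => u.
by case: (u \in S); rewrite ?set_true ?set_false.
Qed.

(** A rooted walk has visited finitely many vertices, which [G n] contains for [n]
    large. *)
Lemma cvg_inside vs : pr (inside_event vs (G n)) @[n --> \oo] --> (1 : R).
Proof.
have Gmono n : {subset G n <= G n.+1} by have [+ _ _] := HG => /(_ n)/fsubsetP.
have FS n : inside_event vs (G n) `<=` inside_event vs (G n.+1).
  move=> o H v /H[X0 [T [rT XS]]]; split=> //; exists T; split=> // i iT.
  by apply: Gmono; exact: XS.
have lim := cvg_pr (P := P) (fun n => measurable_inside vs (G n)) FS.
suff U1 : pr (\bigcup_n inside_event vs (G n)) = 1 by rewrite -U1.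
have mU : measurable (\bigcup_n inside_event vs (G n)).
  by apply: bigcupT_measurable => n; exact: measurable_inside.
pose E v := X v 0%N @^-1` [set v] `&` rooted_event v.
have mE v : measurable (E v).
  by apply: measurableI; [exact: (measurable_walk HD)|exact: measurable_rooted_event].
have E1 v : pr (E v) = 1.
  rewrite /E pr_setI1 ?pr_rooted_event //; [|exact: (measurable_walk HD)|exact: measurable_rooted_event].
  apply/eqP; rewrite eq_le pr_le1 /=; last exact: (measurable_walk HD).
  rewrite -(pr_start v); apply: le_pr; [exact: (measurable_cyl HD)|exact: (measurable_walk HD)|].
  by move=> o [[]].
have allE (s : seq V) : pr [set o | forall v, v \in s -> E v o] = 1.
  elim: s => [|v s IHs]; first by rewrite (_ : mkset _ = setT) ?prT //; apply/seteqP; split.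
  rewrite (_ : mkset _ = E v `&` [set o | forall v, v \in s -> E v o]).
    by rewrite pr_setI1 //; exact: measurable_forall_mem.
  apply/seteqP; split=> o /=.
    by move=> H; split=> [|w ws]; apply: H; rewrite ?mem_head // inE ws orbT.
  by case=> Ev H w; rewrite inE => /orP[/eqP->//|/H].
apply/eqP; rewrite eq_le pr_le1 //= -(allE vs); apply: le_pr => //.
  exact: measurable_forall_mem.
move=> o /= H.
have [l lP] : exists l : seq V, forall v, v \in vs -> X v 0%N o = v /\
    exists T, is_rooted (lerw e p (X v ^~ o) (Y v ^~ o) T) /\
      forall i, (i <= T)%N -> X v i o \in l.
  elim: (vs) H => [|v s IHs] H; first by exists [::].
  have [l lP] : exists l : seq V, forall v, v \in s -> X v 0%N o = v /\
    exists T, is_rooted (lerw e p (X v ^~ o) (Y v ^~ o) T) /\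
      forall i, (i <= T)%N -> X v i o \in l.
    by apply: IHs => w ws; apply: H; rewrite inE ws orbT.
  have [X0 [T rT]] := H v (mem_head _ _).
  exists ([seq X v i o | i <- iota 0 T.+1] ++ l) => w; rewrite inE.
  case/orP=> [/eqP->|/lP[X0' [T' [rT' XT']]]].
    split=> //; exists T; split=> // i iT; rewrite mem_cat map_f //.
    by rewrite mem_iota add0n ltnS.
  by split=> //; exists T'; split=> // i /XT' il; rewrite mem_cat il orbT.
have [n ln] := exhaustion_subset l HG; exists n => // v /lP[X0 [T [rT XT]]].
by split=> //; exists T; split=> // i /XT/ln.
Qed.

Variable phi : nat -> V.
Hypothesis Hphi : bijective phi.

Definition forest_of (o : Omega) : config e :=
  forest e p phi (fun x n => X x n o) (fun x n => Y x n o).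

(** The boundary conditions of the algorithm are random sets, but conditionally on
    the past they are fixed, and the next path has countably many values. *)
Lemma measurable_forest_upto_dep i (M : set V * set {fset V} -> set Omega) :
    (forall F, measurable (M F)) ->
  measurable [set o | M (forest_upto e p phi (fun x n => X x n o) (fun x n => Y x n o) i) o].
Proof.
elim: i M => [|i IHi] M mM; first exact: mM.
pose M' (F : set V * set {fset V}) := [set o |
  M (F.1 `|` [set` lerw_final e p F.1 (X (phi i) ^~ o) (Y (phi i) ^~ o)],
     F.2 `|` [set` trace_edges (lerw_final e p F.1 (X (phi i) ^~ o) (Y (phi i) ^~ o))]) o].
apply: (IHi M') => F.
exact: (@measurable_lerw_final_dep (phi i) F.1
  (fun t => M (F.1 `|` [set` t], F.2 `|` [set` trace_edges t]))).
Qed.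

Lemma measurable_forest_edge a b : measurable [set o | forest_of o a = b].
Proof.
have mtrue : measurable [set o | forest_of o a = true].
  rewrite (_ : mkset _ = \bigcup_i [set o |
    (forest_upto e p phi (fun x n => X x n o) (fun x n => Y x n o) i).2 (val a)]).
    apply: bigcupT_measurable => i.
    apply: (@measurable_forest_upto_dep i (fun F => [set _ | F.2 (val a)])) => F.
    have [Fa|Fa] := pselect (F.2 (val a)).
      by rewrite (_ : mkset _ = setT) //; apply/seteqP; split.
    by rewrite (_ : mkset _ = set0) //; apply/seteqP; split.
  apply/seteqP; split=> o /=; first by move/asboolP=> [i Fi]; exists i.
  by case=> i _ Fi; apply/asboolP; exists i.
case: b => //; rewrite (_ : mkset _ = ~` [set o | forest_of o a = true]).
  exact: measurableC.
by apply/seteqP; split=> o /=; case: (forest_of o a).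
Qed.

Definition pattern (L : seq (edge e * bool)) : set (config e) :=
  [set w | all (fun ab => w ab.1 == ab.2) L].

Lemma measurable_pattern L : measurable [set o | pattern L (forest_of o)].
Proof.
elim: L => [|[a b] L IHL].
  by rewrite (_ : mkset _ = setT) //; apply/seteqP; split.
rewrite (_ : mkset _ = [set o | forest_of o a = b] `&` [set o | pattern L (forest_of o)]).
  by apply: measurableI => //; exact: measurable_forest_edge.
by apply/seteqP; split=> o /=; rewrite /pattern /=; [case/andP=> /eqP|case=> /eqP -> ->].
Qed.

Definition map_pattern (L : seq (edge e * bool)) (h : V -> V) : bool :=
  all (fun ab => has_edge h (val ab.1) == ab.2) L.

(** On the event that the first [k] walks root inside [G n], the algorithm in
    the finite domain [G n] reproduces the restriction of the forest to any edge
    with endpoints among the first [k] vertices; the probability of this event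
    tends to one. *)
Lemma cvg_pattern L :
  weighted_sum e p (G n) (fun h => (map_pattern L h)%:R) id / partition_function e p (G n)
    @[n --> \oo] --> pr [set o | pattern L (forest_of o)].
Proof.
have [psi phiK psiK] := Hphi.
have idx (l : seq V) : exists k, forall z, z \in l -> exists2 j, (j < k)%N & z = phi j.
  elim: l => [|z l [k kP]]; first by exists 0%N.
  exists (maxn (psi z).+1 k) => w; rewrite inE => /orP[/eqP->|/kP[j jk ->]].
    by exists (psi z); rewrite ?psiK // leq_max leqnn.
  by exists j => //; rewrite leq_max jk orbT.
(* The first [k] vertices cover the edges of [L], and the first [k + N0] vertices
   cover [G n]. *)
have [k kP] := idx (flatten [seq enum_fset (val ab.1) | ab <- L]).
have flatE ab z : ab \in L -> z \in val ab.1 ->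
    z \in flatten [seq enum_fset (val ab.1) | ab <- L].
  elim: (L) => //= ab' L' IHL; rewrite inE mem_cat => /orP[/eqP-> ->//|abL zab].
  by rewrite IHL ?orbT.
set r := fun n => _ / _.
pose vs := [seq phi i | i <- iota 0 k].
suff close n : `|pr [set o | pattern L (forest_of o)] - r n|
    <= 1 - pr (inside_event vs (G n)).
  apply/cvgrPdist_le => eps eps0.
  have lim : 1 - pr (inside_event vs (G n)) @[n --> \oo] --> (0 : R).
    by rewrite -(subrr 1); apply: cvgB; [exact: cvg_cst|exact: cvg_inside].
  move/cvgrPdist_le: lim => /(_ eps eps0); apply: filterS => n.
  rewrite sub0r normrN => le_eps; apply: le_trans (close n) _.
  exact: le_trans (ler_norm _) le_eps.
have [N0 N0P] := idx (G n).
pose vs' := [seq phi i | i <- iota k N0].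
have vsE : vs ++ vs' = [seq phi i | i <- iota 0 (k + N0)].
  by rewrite -map_cat -iotaD.
have uvs : uniq (vs ++ vs').
  by rewrite vsE map_inj_uniq ?iota_uniq //; exact: can_inj phiK.
have sub : {subset G n <= vs ++ vs'}.
  move=> z /N0P[j jN ->]; rewrite vsE map_f // mem_iota add0n ltn_addl //.
have ind : independent_of setT (vs ++ vs').
  by move=> hs mhs; rewrite setTI prT mul1r pr_cyls.
have law f := pr_wired id f uvs sub measurableT ind.
have W1 : pr (wired_event (vs ++ vs') (G n) id (fun=> true)) = 1.
  have Z0 : 0 < partition_function e p (G n) by exact: (@partition_function_gt0 _ _ _ _ x0).
  rewrite -[RHS](divff (lt0r_neq0 Z0)).
  by have := law (fun=> true); rewrite setTI prT mul1r.
have WE : pr (wired_event (vs ++ vs') (G n) id (map_pattern L)) = r n.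
  by have := law (map_pattern L); rewrite setTI prT mul1r.
set A := [set o | _]; set W := wired_event _ _ _ (map_pattern L) in WE *.
pose C := inside_event vs (G n) `&` wired_event (vs ++ vs') (G n) id (fun=> true).
have mA : measurable A by exact: measurable_pattern.
have mW : measurable W by exact: measurable_wired.
have mI : measurable (inside_event vs (G n)) by exact: measurable_inside.
have mC : measurable C by apply: measurableI => //; exact: measurable_wired.
have C1 : pr C = pr (inside_event vs (G n)).
  by apply: pr_setI1 => //; exact: measurable_wired.
have AW : A `&` C = W `&` C.
  have key o : C o -> A o <-> W o.
    move=> [Io]; rewrite /W /A /wired_event /=.
    case hW : wired_state => [[U' h]|] //= _.
    have eL : {in L, forall ab, forest_of o ab.1 = has_edge h (val ab.1)}.
      move=> ab abL.
      have ends z : z \in val ab.1 -> exists2 j, (j < k)%N & z = phi j.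
        by move=> za; apply: kP; exact: flatE za.
      have roots j : (j < k)%N ->
          roots_inside e p (fun x n => X x n o) (fun x n => Y x n o) (G n) (phi j).
        by move=> jk; apply: Io; rewrite map_f // mem_iota.
      have [E1 E2] := wired_state_has_edge roots ends hW.
      by apply/asboolP/idP.
    rewrite /pattern /map_pattern /=.
    by split; move=> /allP H; apply/allP => ab abL; have := H _ abL; rewrite eL.
  by apply/seteqP; split=> o [H Co]; split=> //; apply/(key o Co).
have out (B : set Omega) : measurable B -> 0 <= pr (B `\` C) <= 1 - pr C.
  move=> mB; rewrite pr_ge0 /= lerBrDr -(prT P) (prDI P measurableT mC) setTI lerD2r.
  by apply: le_pr => [||o []//]; exact: measurableD.
rewrite -WE -C1 (prDI P mA mC) (prDI P mW mC) AW.
have /andP[a0 a1] := out _ mA; have /andP[b0 b1] := out _ mW.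
by rewrite ler_norml; apply/andP; split; lra.
Qed.

End Law.

(** * Equality of the two laws *)

Lemma connected_exit (V : countType) (e : rel V) (U : {fset V}) x :
    infinite_set [set: V] -> connected_on e [set: V] -> x \in U ->
  exists ys y, [/\ path e x (rcons ys y), uniq (x :: ys), all [in U] ys & y \notin U].
Proof.
move=> Hinf [_ Hconn] xU.
have [w wU] : exists w, w \notin U.
  apply: contrapT => no; apply: Hinf; apply: (sub_finite_set _ (finite_fset U)).
  by move=> w _ /=; apply: contrapT => /negP wU; apply: no; exists w.
have [s [ps ls _]] := Hconn x w I I.
have [s' [ps' us' ls']] : exists s', [/\ path e x s', uniq (x :: s') & last x s' = w].
  by case: (shortenP ps) ls => s' ? ? _ ?; exists s'.
have hs : has [predC [in U]] s'.
  apply/hasP; exists w; last by [].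
  case: s' ls' {ps' us'} => [|z s'] /=; first by move=> xw; rewrite -xw xU in wU.
  by move=> <-; exact: mem_last.
move: ps' us' {ls'}; case: (split_find hs) => y s1 s2 yU s1U.
rewrite cat_path => /andP[ps1 _] us; exists s1, y; split=> //.
  move: us; rewrite /= mem_cat mem_rcons inE cat_uniq rcons_uniq !negb_or.
  by case/andP=> /andP[/andP[_ ->] _] /andP[/andP[_ ->] _].
by apply/allP => z zs1; have /hasPn/(_ z zs1) := s1U; rewrite /= negbK.
Qed.

Lemma connected_neighbour (V : countType) (e : rel V) v :
    infinite_set [set: V] -> connected_on e [set: V] -> exists u, e v u.
Proof.
move=> Hinf Hconn; have [ys [y [+ _ _ _]]] := connected_exit Hinf Hconn (fset11 v).
by case: ys => [|z ys] /= /andP[ev _]; [exists y|exists z].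
Qed.

Lemma cylinder_sub_pattern (V : countType) (e : rel V) (A : set (config e)) :
  cylinder_sigma_field A -> <<s [set B | exists L, B = @pattern V e L] >> A.
Proof.
apply: sub_sigma_algebra2 => _ [a [b ->]]; exists [:: (a, b)].
by apply/seteqP; split=> w /=; rewrite /pattern /= andbT => /eqP.
Qed.

Lemma pattern_setI_closed (V : countType) (e : rel V) :
  setI_closed [set B | exists L, B = @pattern V e L].
Proof.
move=> _ _ [L ->] [L' ->]; exists (L ++ L').
by apply/seteqP; split=> w /=; rewrite /pattern /= all_cat; [case=> -> ->|move/andP].
Qed.

(** Patterns are stable under intersection and generate the cylinder sets. *)
Lemma pattern_law_unique (R : realType) (V : countType) (e : rel V)
    (d1 d2 : measure_display) (Omega1 : measurableType d1) (Omega2 : measurableType d2)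
    (P1 : probability Omega1 R) (P2 : probability Omega2 R)
    (F1 : Omega1 -> config e) (F2 : Omega2 -> config e) :
    (forall L, measurable (F1 @^-1` pattern L)) ->
    (forall L, measurable (F2 @^-1` pattern L)) ->
    (forall L, P1 (F1 @^-1` pattern L) = P2 (F2 @^-1` pattern L)) ->
  forall A, cylinder_sigma_field A -> P1 (F1 @^-1` A) = P2 (F2 @^-1` A).
Proof.
move=> mF1 mF2 F12 A /cylinder_sub_pattern.
pose H : set (set (config e)) := [set B | [/\ measurable (F1 @^-1` B),
  measurable (F2 @^-1` B) & pr P1 (F1 @^-1` B) = pr P2 (F2 @^-1` B)]].
suff sub : <<s [set B | exists L, B = @pattern V e L] >> `<=` H.
  by move/sub=> [m1 m2 E]; rewrite (prE P1 m1) (prE P2 m2) E.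
apply: lambda_system_subset => //; first exact: pattern_setI_closed; last first.
  by move=> _ [L ->]; split=> //; rewrite /pr F12.
split=> //.
- by split; rewrite ?preimage_setT ?prT //; exact: measurableT.
- move=> B C CB [mB1 mB2 EB] [mC1 mC2 EC]; rewrite /H /=.
  have mD1 : measurable (F1 @^-1` (B `\` C)) by exact: measurableD mB1 mC1.
  have mD2 : measurable (F2 @^-1` (B `\` C)) by exact: measurableD mB2 mC2.
  split=> //; apply: (addIr (pr P1 (F1 @^-1` C))); rewrite [in RHS]EC.
  have E1 := prDI P1 mB1 mC1; have E2 := prDI P2 mB2 mC2.
  rewrite -preimage_setI (setIidr CB) in E1; rewrite -preimage_setI (setIidr CB) in E2.
  by rewrite -[LHS]E1 -[RHS]E2.
- move=> B ndB HB; have mB1 n : measurable (F1 @^-1` B n) by case: (HB n).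
  have mB2 n : measurable (F2 @^-1` B n) by case: (HB n).
  rewrite /H /= !preimage_bigcup; split; [exact: bigcupT_measurable|exact: bigcupT_measurable|].
  have BS n : B n `<=` B n.+1 by apply/subsetPset/ndB.
  have c1 := cvg_pr (P := P1) mB1 (fun n => preimage_subset (f := F1) (BS n)).
  have c2 := cvg_pr (P := P2) mB2 (fun n => preimage_subset (f := F2) (BS n)).
  have E : (fun n => pr P1 (F1 @^-1` B n)) = (fun n => pr P2 (F2 @^-1` B n)).
    by apply/funext => n; case: (HB n).
  by rewrite E in c1; rewrite -(cvg_lim _ c1) // (cvg_lim _ c2).
Qed.

Theorem theorem3p3p2 (R : realType) (V : countType) (e : rel V)
  (He : simple_graph e) (Hinf : infinite_set [set: V])
  (Hconn : connected_on e [set: V]) (Hfin : locally_finite e)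
  (G : nat -> {fset V}) (HG : exhaustion e G)
  (p : seq V -> R) (Hp : weight_function e p)
  (Hloop : loop_assumption e G p)
  (phi tau : nat -> V) (Hphi : bijective phi) (Htau : bijective tau)
  (* two arbitrary realizations of the families driving the algorithm *)
  (d1 : measure_display) (Omega1 : measurableType d1)
  (P1 : probability Omega1 R)
  (X1 : V -> nat -> Omega1 -> V) (Y1 : V -> nat -> Omega1 -> R)
  (H1 : driving_families P1 e X1 Y1)
  (d2 : measure_display) (Omega2 : measurableType d2)
  (P2 : probability Omega2 R)
  (X2 : V -> nat -> Omega2 -> V) (Y2 : V -> nat -> Omega2 -> R)
  (H2 : driving_families P2 e X2 Y2) :
  forall A : set (config e), cylinder_sigma_field A ->
    forest_law p P1 X1 Y1 phi A = forest_law p P2 X2 Y2 tau A.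
Proof.
have [x0 _] : exists x0 : V, True by case: Hconn => -[x _] _; exists x.
have Hdeg v : exists u, e v u by exact: connected_neighbour.
have Hexit (U : {fset V}) x : x \in U -> exists ys y,
  [/\ path e x (rcons ys y), uniq (x :: ys), all [in U] ys & y \notin U].
  exact: connected_exit.
have [_ Hirr] := He.
have c1 L := cvg_pattern x0 Hfin Hp Hdeg Hexit Hirr H1 HG Hloop Hphi L.
have c2 L := cvg_pattern x0 Hfin Hp Hdeg Hexit Hirr H2 HG Hloop Htau L.
have m1 L := measurable_pattern p H1 phi L; have m2 L := measurable_pattern p H2 tau L.
apply: pattern_law_unique => // L.
rewrite (prE P1 (m1 L)) (prE P2 (m2 L)); congr EFin.
by rewrite -[LHS](cvg_lim _ (c1 L)) // -[RHS](cvg_lim _ (c2 L)).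
Qed.
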